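(* For every group $G$ the functor $\frac{\mathbf{ffff}}{(\mathbf{ffr}+\mathbf{rff})\cap\mathbf{ffff}}$ on $\mathrm{Pres}(G)$ is constant, being a natural quotient of $\mathbf g^2\otimes_{\mathbb Z[G]}\mathbf g^2$ (namely the image of the natural map $\mathbf g^2\otimes_{\mathbb Z[G]}\mathbf g^2=\frac{\mathbf{ff}}{\mathbf r\cap\mathbf{ff}}\otimes_{\mathbb Z[G]}\frac{\mathbf{ff}}{\mathbf r\cap\mathbf{ff}}\to\frac{\mathbf{fff}}{\mathbf{ffr}+\mathbf{rff}}$), and $$\mathrm{lim}^1(\mathbf{ffr}+\mathbf{rff})\cong\frac{\mathbf{ffff}}{(\mathbf{ffr}+\mathbf{rff})\cap\mathbf{ffff}},\qquad \mathrm{lim}^i(\mathbf{ffr}+\mathbf{rff})=0\ \text{ for } i\ge 2.$$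
   Context: For a group $G$, $\mathrm{Pres}(G)$ is the category whose objects are epimorphisms $F\twoheadrightarrow G$ from free groups and whose morphisms are group homomorphisms over $G$. Functorial ideals of $\mathbb Z[F]$: $\mathbf f=\ker\{\mathbb Z[F]\to\mathbb Z\}$, $\mathbf r=\ker\{\mathbb Z[F]\to\mathbb Z[G]\}$. Words in $\mathbf f,\mathbf r$ denote products of ideals (e.g. $\mathbf{ffr}=\mathbf f\cdot\mathbf f\cdot\mathbf r$) and $+$ is the sum of ideals; such expressions and their quotients are functors $\mathrm{Pres}(G)\to\mathrm{Ab}$. $\mathrm{lim}^i$ denotes the $i$-th right derived functor of the limit functor $\mathrm{Ab}^{\mathrm{Pres}(G)}\to\mathrm{Ab}$ (set-theoretic existence assumed, e.g. in a larger universe). $\mathbf g$ is the augmentation ideal of $\mathbb Z[G]$. A functor is constant if it is (naturally isomorphic to one) sending every object to the same group and every morphism to the identity. *)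

(* Defs.v *)
From HB Require Import structures.
From mathcomp Require Import all_boot all_order all_algebra.
From mathcomp Require Import boolp finmap monalg.
From mathcomp Require classical_sets.

Set Implicit Arguments.
Unset Strict Implicit.
Unset Printing Implicit Defensive.

Import GRing.Theory.

Local Open Scope ring_scope.

(* MathComp places [groupType] and [zmodType] at one and the same universe
   level, so that the limit of a functor into [zmodType] indexed by all
   presentations of a group would not be a [zmodType] again.  The record below
   is the usual notion of group, at a universe level of its own that the
   instance on [lim] below forces to be strictly smaller than that of
   [zmodType]; each such group is canonically a [groupType]. *)
Record group : Type := Group {
  gsort :> Type;
  gop : gsort -> gsort -> gsort;
  gunit : gsort;
  ginv : gsort -> gsort;
  gopA : associative gop;
  gop1g : left_id gunit gop;
  gopg1 : right_id gunit gop;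
  gopVg : left_inverse gunit ginv gop;
  gopgV : right_inverse gunit ginv gop
}.

HB.instance Definition _ (F : group) := gen_eqMixin (gsort F).
HB.instance Definition _ (F : group) := gen_choiceMixin (gsort F).
HB.instance Definition _ (F : group) :=
  isGroup.Build (gsort F)
    (@gopA F) (@gop1g F) (@gopg1 F) (@gopVg F) (@gopgV F).

Record ghom (F H : group) : Type := GHom {
  ghom_fun :> F -> H;
  ghomM : {morph ghom_fun : x y / (x * y)%g}
}.

Lemma ghom1 (F H : group) (h : ghom F H) : h 1%g = 1%g.
Proof.
have /(congr1 (fun y => (h 1%g)^-1 * y)%g) := ghomM h 1%g 1%g.
by rewrite mulg1 mulKg mulVg => <-.
Qed.

Lemma ghomP (F H : group) (h k : ghom F H) : h =1 k -> h = k.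
Proof.
case: h k => [h hM] [k kM] /= /funext E.
by case: k / E kM => kM; congr GHom; exact: Prop_irrelevance.
Qed.

Definition ghom_id (F : group) : ghom F F :=
  @GHom F F id (fun _ _ => erefl).

Lemma ghom_compM (F H K : group) (k : ghom H K) (h : ghom F H) :
  {morph (fun x => k (h x)) : x y / (x * y)%g}.
Proof. by move=> x y /=; rewrite !ghomM. Qed.

Definition ghom_comp (F H K : group) (k : ghom H K) (h : ghom F H) :
  ghom F K := GHom (ghom_compM k h).

Definition is_free (F : group) : Prop :=
  exists (X : Type) (i : X -> F),
  forall (H : group) (f : X -> H),
  exists h : ghom F H,
    (forall x, h (i x) = f x) /\
    (forall h' : ghom F H, (forall x, h' (i x) = f x) -> h' =1 h).

Record category : Type := Category {
  ob :> Type;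
  hom : ob -> ob -> Type;
  idm : forall a, hom a a;
  comp : forall a b c, hom b c -> hom a b -> hom a c;
  comp1m : forall a b (h : hom a b), comp (idm b) h = h;
  compm1 : forall a b (h : hom a b), comp h (idm a) = h;
  compA : forall a b c d (k : hom c d) (h : hom b c) (g : hom a b),
    comp k (comp h g) = comp (comp k h) g
}.

Record abfunctor (C : category) : Type := AbFunctor {
  fob :> C -> zmodType;
  fmap : forall a b : C, hom a b -> {additive fob a -> fob b};
  fmap_id : forall (a : C) (x : fob a), fmap (idm a) x = x;
  fmap_comp : forall (a b c : C) (k : hom b c) (h : hom a b) (x : fob a),
    fmap (comp k h) x = fmap k (fmap h x)
}.
Arguments fmap {C} _ {a b} _.

Record nattrans (C : category) (A B : abfunctor C) : Type := NatTrans {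
  ntmap :> forall c : C, {additive A c -> B c};
  ntmapE : forall (a b : C) (h : hom a b) (x : A a),
    ntmap b (fmap A h x) = fmap B h (ntmap a x)
}.

Definition nat_iso (C : category) (A B : abfunctor C) (t : nattrans A B) : Prop :=
  forall c, bijective (t c).

Section Const.
Variables (C : category) (V : zmodType).

Definition const_functor : abfunctor C :=
  @AbFunctor C (fun _ => V) (fun _ _ _ => idfun : {additive V -> V})
    (fun _ _ => erefl) (fun _ _ _ _ _ _ => erefl).

End Const.

Definition is_constant (C : category) (A : abfunctor C) : Prop :=
  exists (V : zmodType) (t : nattrans A (const_functor C V)), nat_iso t.

Definition ab_isomorphic (V W : zmodType) : Prop :=
  exists f : {additive V -> W}, bijective f.

Record subgrp (V : zmodType) : Type := SubGrp {
  smem :> V -> Prop;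
  smem0 : smem 0;
  smemB : forall x y, smem x -> smem y -> smem (x - y)
}.

Section SubgrpTheory.
Variables (V : zmodType) (A : subgrp V).

Lemma smemN x : A x -> A (- x).
Proof. by move=> Ax; rewrite -sub0r; apply: smemB => //; apply: smem0. Qed.

Lemma smemD x y : A x -> A y -> A (x + y).
Proof. by move=> Ax Ay; rewrite -[y]opprK; apply: smemB => //; apply: smemN. Qed.

Definition smemb : {pred V} := fun x => `[< A x >].

Lemma smembP x : reflect (A x) (x \in smemb).
Proof. exact: asboolP. Qed.

Lemma smemb_closed : zmod_closed smemb.
Proof.
split=> [|x y /smembP Ax /smembP Ay]; apply/smembP; first exact: smem0.
exact: smemB.
Qed.

HB.instance Definition _ := GRing.isZmodClosed.Build V smemb smemb_closed.

Definition subgrp_type : Type := {x : V | x \in smemb}.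

HB.instance Definition _ := Choice.on subgrp_type.
HB.instance Definition _ := SubType.on subgrp_type.
HB.instance Definition _ := [SubChoice_isSubZmodule of subgrp_type by <:].

Definition subgrp_mk (x : V) (Ax : A x) : subgrp_type :=
  exist _ x (introT (smembP x) Ax).

Lemma subgrp_valP (x : subgrp_type) : A (val x).
Proof. exact/smembP/(valP x). Qed.

End SubgrpTheory.

Section Subquotient.
Variables (V : zmodType) (A B : subgrp V).

Definition in_sub : {pred subgrp_type A} := fun x => `[< B (val x) >].

Lemma in_sub_closed : zmod_closed in_sub.
Proof.
split=> [|x y /asboolP Bx /asboolP By]; apply/asboolP.
  by rewrite raddf0; exact: smem0.
by rewrite raddfB; exact: smemB.
Qed.

HB.instance Definition _ :=
  GRing.isZmodClosed.Build (subgrp_type A) in_sub in_sub_closed.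

(* The quotient A / (A ∩ B); it is A / B when B is contained in A. *)
Definition subquot : Type := Quotient.quot in_sub.

HB.instance Definition _ := Choice.on subquot.
HB.instance Definition _ := GRing.Zmodule.on subquot.

Definition subquot_class (x : subgrp_type A) : subquot :=
  \pi_(Quotient.quot in_sub)%qT x.

Lemma subquot_class_is_additive : zmod_morphism subquot_class.
Proof. exact: raddfB. Qed.

HB.instance Definition _ :=
  GRing.isZmodMorphism.Build (subgrp_type A) subquot subquot_class
    subquot_class_is_additive.

Lemma subquot_classP (q : subquot) : exists x, q = subquot_class x.
Proof. by exists (repr q); rewrite /subquot_class reprK. Qed.

Lemma subquot_class_eq (x y : subgrp_type A) :
  subquot_class x = subquot_class y <-> B (val x - val y).
Proof.
rewrite /subquot_class; split=> [/eqP|H].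
  by rewrite -Quotient.idealrBE => /asboolP; rewrite raddfB.
by apply/eqP; rewrite -Quotient.idealrBE; apply/asboolP; rewrite raddfB.
Qed.

End Subquotient.

(* [x] as an element of A / (A ∩ B), for x in A *)
Definition scls (V : zmodType) (A B : subgrp V) (x : V) (Ax : A x) :
  subquot A B := subquot_class B (subgrp_mk Ax).

Section InducedMaps.
Variables (V W : zmodType) (phi : {additive V -> W}).
Variables (A B : subgrp V) (A' B' : subgrp W).
Hypothesis phiA : forall x, A x -> A' (phi x).
Hypothesis phiB : forall x, B x -> B' (phi x).

Definition subgrp_map (x : subgrp_type A) : subgrp_type A' :=
  subgrp_mk (phiA (subgrp_valP x)).

Lemma subgrp_map_is_additive : zmod_morphism subgrp_map.
Proof. by move=> x y; apply: val_inj; rewrite /= raddfB. Qed.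

HB.instance Definition _ :=
  GRing.isZmodMorphism.Build (subgrp_type A) (subgrp_type A') subgrp_map
    subgrp_map_is_additive.

Definition subquot_fun (q : subquot A B) : subquot A' B' :=
  subquot_class B' (subgrp_map (repr q)).

Lemma subquot_funE x :
  subquot_fun (subquot_class B x) = subquot_class B' (subgrp_map x).
Proof.
apply/subquot_class_eq; rewrite /= -raddfB; apply: phiB.
by apply/(@subquot_class_eq _ A B); rewrite /subquot_class reprK.
Qed.

Lemma subquot_fun_is_additive : zmod_morphism subquot_fun.
Proof.
move=> p q; have [x ->] := subquot_classP p; have [y ->] := subquot_classP q.
by rewrite -raddfB !subquot_funE !raddfB.
Qed.

HB.instance Definition _ :=
  GRing.isZmodMorphism.Build (subquot A B) (subquot A' B') subquot_fun
    subquot_fun_is_additive.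

Definition subquot_map : {additive subquot A B -> subquot A' B'} := subquot_fun.

Lemma subquot_mapE x :
  subquot_map (subquot_class B x) = subquot_class B' (subgrp_map x).
Proof. exact: subquot_funE. Qed.

End InducedMaps.

Section GeneratedSubgroup.
Variables (V : zmodType) (S : V -> Prop).

Definition gen_mem (x : V) : Prop :=
  forall A : subgrp V, (forall s, S s -> A s) -> A x.

Lemma gen_mem0 : gen_mem 0.
Proof. by move=> A _; exact: smem0. Qed.

Lemma gen_memB x y : gen_mem x -> gen_mem y -> gen_mem (x - y).
Proof. by move=> Sx Sy A SA; apply: smemB; [exact: Sx | exact: Sy]. Qed.

Definition gen_subgrp : subgrp V := SubGrp gen_mem0 gen_memB.

End GeneratedSubgroup.

Section KernelImage.
Variables (V W : zmodType) (phi : {additive V -> W}).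

Lemma ker_mem0 : phi 0 = 0. Proof. exact: raddf0. Qed.

Lemma ker_memB x y : phi x = 0 -> phi y = 0 -> phi (x - y) = 0.
Proof. by move=> x0 y0; rewrite raddfB x0 y0 subrr. Qed.

Definition ker_subgrp : subgrp V :=
  @SubGrp V (fun x => phi x = 0) ker_mem0 ker_memB.

Lemma im_mem0 : exists x, phi x = 0. Proof. by exists 0; exact: raddf0. Qed.

Lemma im_memB y z :
  (exists x, phi x = y) -> (exists x, phi x = z) -> exists x, phi x = y - z.
Proof. by move=> [x <-] [x' <-]; exists (x - x'); rewrite raddfB. Qed.

Definition im_subgrp : subgrp W :=
  @SubGrp W (fun y => exists x, phi x = y) im_mem0 im_memB.

End KernelImage.

Definition zero_subgrp (V : zmodType) : subgrp V :=
  @SubGrp V (fun x => x = 0) erefl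
    (fun x y x0 y0 => etrans (congr2 (fun a b => a - b) x0 y0) (subrr 0)).

Section ImageFunctor.
Variables (C : category) (A B : abfunctor C) (t : nattrans A B).

Lemma image_stable (a b : C) (h : hom a b) (y : B a) :
  im_subgrp (t a) y -> im_subgrp (t b) (fmap B h y).
Proof. by move=> [x <-]; exists (fmap A h x); rewrite ntmapE. Qed.

Definition image_fmap (a b : C) (h : hom a b) :
  {additive subgrp_type (im_subgrp (t a)) -> subgrp_type (im_subgrp (t b))} :=
  subgrp_map (image_stable h).

Lemma image_fmap_id (a : C) (x : subgrp_type (im_subgrp (t a))) :
  image_fmap (idm a) x = x.
Proof. by apply: val_inj; rewrite /= fmap_id. Qed.

Lemma image_fmap_comp (a b c : C) (k : hom b c) (h : hom a b)
    (x : subgrp_type (im_subgrp (t a))) :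
  image_fmap (comp k h) x = image_fmap k (image_fmap h x).
Proof. by apply: val_inj; rewrite /= fmap_comp. Qed.

Definition image_functor : abfunctor C :=
  @AbFunctor C (fun c => subgrp_type (im_subgrp (t c))) image_fmap
    image_fmap_id image_fmap_comp.

End ImageFunctor.

Section Limit.
Variables (C : category) (A : abfunctor C).

Definition compatible (x : forall c : C, A c) : Prop :=
  forall (a b : C) (h : hom a b), fmap A h (x a) = x b.

Record lim : Type := Lim {
  lim_val :> forall c : C, A c;
  lim_valP : compatible lim_val
}.

Lemma limP (x y : lim) : (forall c, x c = y c) -> x = y.
Proof.
case: x y => [x xP] [y yP] /= xy.
have E : x = y by exact: functional_extensionality_dep.
by case: y / E yP {xy} => yP; congr Lim; exact: Prop_irrelevance.
Qed.

HB.instance Definition _ := gen_eqMixin lim.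
HB.instance Definition _ := gen_choiceMixin lim.

Lemma lim_zeroP : compatible (fun c => 0).
Proof. by move=> a b h; rewrite raddf0. Qed.

Lemma lim_oppP (x : lim) : compatible (fun c => - x c).
Proof. by move=> a b h; rewrite raddfN lim_valP. Qed.

Lemma lim_addP (x y : lim) : compatible (fun c => x c + y c).
Proof. by move=> a b h; rewrite raddfD !lim_valP. Qed.

Lemma lim_addA : associative (fun x y => Lim (lim_addP x y)).
Proof. by move=> x y z; apply: limP => c /=; rewrite addrA. Qed.

Lemma lim_addC : commutative (fun x y => Lim (lim_addP x y)).
Proof. by move=> x y; apply: limP => c /=; rewrite addrC. Qed.

Lemma lim_add0 : left_id (Lim lim_zeroP) (fun x y => Lim (lim_addP x y)).
Proof. by move=> x; apply: limP => c /=; rewrite add0r. Qed.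

Lemma lim_addN :
  left_inverse (Lim lim_zeroP) (fun x => Lim (lim_oppP x))
    (fun x y => Lim (lim_addP x y)).
Proof. by move=> x; apply: limP => c /=; rewrite addNr. Qed.

HB.instance Definition _ :=
  GRing.isZmodule.Build lim lim_addA lim_addC lim_add0 lim_addN.

End Limit.

Section LimitMap.
Variables (C : category) (A B : abfunctor C) (t : nattrans A B).

Lemma lim_mapP (x : lim A) : compatible (fun c => t c (x c)).
Proof. by move=> a b h; rewrite -ntmapE lim_valP. Qed.

Definition lim_map (x : lim A) : lim B := Lim (lim_mapP x).

Lemma lim_map_is_additive : zmod_morphism lim_map.
Proof. by move=> x y; apply: limP => c /=; rewrite -raddfB. Qed.

HB.instance Definition _ :=
  GRing.isZmodMorphism.Build (lim A) (lim B) lim_map lim_map_is_additive.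

End LimitMap.

Definition cohomology (X : nat -> zmodType)
    (d : forall n, {additive X n -> X n.+1}) (n : nat) : zmodType :=
  match n with
  | 0 => subquot (ker_subgrp (d 0%N)) (zero_subgrp (X 0%N))
  | m.+1 => subquot (ker_subgrp (d m.+1)) (im_subgrp (d m))
  end.

(* Exactness, in particular monomorphy, is pointwise in Ab^C. *)
Definition injective_object (C : category) (I : abfunctor C) : Prop :=
  forall (A B : abfunctor C) (j : nattrans A B) (f : nattrans A I),
  (forall c, injective (j c)) ->
  exists g : nattrans B I, forall c x, g c (j c x) = f c x.

Record injective_resolution (C : category) (A : abfunctor C) : Type :=
  InjectiveResolution {
    ires_ob : nat -> abfunctor C;
    ires_d : forall n, nattrans (ires_ob n) (ires_ob n.+1);
    ires_aug : nattrans A (ires_ob 0%N);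
    ires_inj : forall n, injective_object (ires_ob n);
    ires_aug_mono : forall c, injective (ires_aug c);
    ires_exact0 : forall c x,
      ires_d 0%N c x = 0 <-> exists y, ires_aug c y = x;
    ires_exact : forall n c x,
      ires_d n.+1 c x = 0 <-> exists y, ires_d n c y = x
  }.

(* The i-th cohomology of lim I^0 -> lim I^1 -> lim I^2 -> ..., that is, the
   value of the i-th right derived functor of lim, computed from the given
   injective resolution. *)
Definition limi (C : category) (A : abfunctor C) (I : injective_resolution A)
    (i : nat) : zmodType :=
  cohomology (fun n => lim_map (ires_d I n) : {additive _ -> _}) i.

(* [{malg int[F]}] is the free abelian group on F; MathComp only makes it a
   ring when F is a monoid without nontrivial units. *)
Definition group_ring (F : group) : Type := {malg int[F]}.

HB.instance Definition _ (F : group) := GRing.Zmodule.on (group_ring F).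

Section LinearExtension.
Variables (K : choiceType) (V : zmodType) (f : K -> V).

Definition linext (x : {malg int[K]}) : V := \sum_(k <- msupp x) f k *~ x@_k.

Lemma linextEw (d : {fset K}) (x : {malg int[K]}) :
  (msupp x `<=` d)%fset -> linext x = \sum_(k <- d) f k *~ x@_k.
Proof.
move=> le; rewrite /linext (big_fset_incl _ le) //= => k _ /mcoeff_outdom ->.
by rewrite mulr0z.
Qed.

Lemma linext_is_additive : zmod_morphism linext.
Proof.
move=> x y; pose d := (msupp x `|` msupp y)%fset.
rewrite (@linextEw d x) ?fsubsetUl // (@linextEw d y) ?fsubsetUr //.
rewrite (@linextEw d (x - y)) ?msuppB_le // -sumrB.
by apply: eq_bigr => k _; rewrite mcoeffB mulrzBr.
Qed.

HB.instance Definition _ :=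
  GRing.isZmodMorphism.Build {malg int[K]} V linext linext_is_additive.

Lemma linextU k (n : int) : linext << n *g k >> = f k *~ n.
Proof. by rewrite (linextEw msuppU_le) big_seq_fset1 mcoeffUU. Qed.

Lemma malgUz k (n : int) : << n *g k >> = << k >> *~ n :> {malg int[K]}.
Proof. by rewrite -[in LHS](intz n) -raddfMz. Qed.

Lemma linext_unique (g : {additive {malg int[K]} -> V}) :
  (forall k, g << k >> = f k) -> g =1 linext.
Proof.
move=> gE x; rewrite [in LHS](monalgE x) raddf_sum; apply: eq_bigr => k _.
by rewrite malgUz raddfMz gE.
Qed.

End LinearExtension.

Lemma malg_additive_ext (K : choiceType) (V : zmodType)
    (g h : {malg int[K]} -> V) (gB : zmod_morphism g) (hB : zmod_morphism h) :
  (forall k, g << k >> = h << k >>) -> g =1 h.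
Proof.
pose gA := GRing.isZmodMorphism.Build _ _ g gB.
pose hA := GRing.isZmodMorphism.Build _ _ h hB.
pose g' : {additive {malg int[K]} -> V} := HB.pack g gA.
pose h' : {additive {malg int[K]} -> V} := HB.pack h hA.
move=> E x; apply: (etrans (@linext_unique _ _ (fun k => h << k >>) g' E x)).
by symmetry; exact: (@linext_unique _ _ (fun k => h << k >>) h').
Qed.

Section GroupRing.
Variable F : group.
Implicit Types (x y z : {malg int[F]}).

Definition gr_mul x y : {malg int[F]} :=
  linext (fun k => linext (fun l => << (k * l)%g >>) y) x.

Definition gr_one : {malg int[F]} := << 1%g >>.

Lemma gr_mulBl y : zmod_morphism (gr_mul^~ y).
Proof. by move=> x x'; rewrite /gr_mul raddfB. Qed.

Lemma gr_mulBr x : zmod_morphism (gr_mul x).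
Proof.
move=> y y'; rewrite /gr_mul /linext -sumrB; apply: eq_bigr => k _.
rewrite -mulrzBl; congr (_ *~ _).
exact: (raddfB (linext (fun l => << (k * l)%g >>)) y y').
Qed.

Lemma gr_mulUU (k l : F) : gr_mul << k >> << l >> = << (k * l)%g >>.
Proof. by rewrite /gr_mul !linextU. Qed.

Lemma gr_mulA : associative gr_mul.
Proof.
move=> x y z; move: x; apply: malg_additive_ext => [x x'|x x'|k].
- by rewrite gr_mulBl.
- by rewrite !gr_mulBl.
move: y; apply: malg_additive_ext => [y y'|y y'|l].
- by rewrite gr_mulBl gr_mulBr.
- by rewrite gr_mulBr gr_mulBl.
move: z; apply: malg_additive_ext => [z z'|z z'|m].
- by rewrite !gr_mulBr.
- by rewrite gr_mulBr.
by rewrite !gr_mulUU mulgA.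
Qed.

Lemma gr_mul1 : left_id gr_one gr_mul.
Proof.
apply: malg_additive_ext => [x y|x y|k] //; first by rewrite gr_mulBr.
by rewrite gr_mulUU mul1g.
Qed.

Lemma gr_mulr1 : right_id gr_one gr_mul.
Proof.
apply: malg_additive_ext => [x y|x y|k] //; first by rewrite gr_mulBl.
by rewrite gr_mulUU mulg1.
Qed.

Lemma gr_mulDl : left_distributive gr_mul +%R.
Proof.
by move=> x y z; rewrite -[y in LHS]opprK gr_mulBl -[- y]sub0r gr_mulBl
  -{1}(subrr y) gr_mulBl subrr sub0r opprK.
Qed.

Lemma gr_mulDr : right_distributive gr_mul +%R.
Proof.
by move=> z x y; rewrite -[y in LHS]opprK gr_mulBr -[- y]sub0r gr_mulBr
  -{1}(subrr y) gr_mulBr subrr sub0r opprK.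
Qed.

Lemma gr_one_neq0 : gr_one != 0.
Proof. by rewrite monalgU_eq0. Qed.

HB.instance Definition _ :=
  GRing.Zmodule_isNzRing.Build (group_ring F)
    gr_mulA gr_mul1 gr_mulr1 gr_mulDl gr_mulDr gr_one_neq0.

End GroupRing.

Definition gr_of (F : group) (k : F) : group_ring F := << k >>.

Lemma gr_ofM (F : group) (k l : F) : gr_of (k * l)%g = gr_of k * gr_of l.
Proof. by rewrite /gr_of -gr_mulUU. Qed.

Lemma gr_ext (F : group) (V : zmodType) (g h : group_ring F -> V)
    (gB : zmod_morphism g) (hB : zmod_morphism h) :
  (forall k, g (gr_of k) = h (gr_of k)) -> g =1 h.
Proof. exact: malg_additive_ext. Qed.

Definition augmentation (F : group) (x : group_ring F) : int :=
  linext (fun=> 1) x.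

HB.instance Definition _ (F : group) :=
  GRing.Additive.copy (@augmentation F)
    (linext (fun=> 1) : {malg int[F]} -> int).

Definition gr_map (F H : group) (h : ghom F H) (x : group_ring F) :
  group_ring H := linext (fun k => gr_of (h k)) x.

Section GrMap.
Variables (F H : group) (h : ghom F H).

Lemma gr_mapB : zmod_morphism (gr_map h).
Proof. by move=> x y; rewrite /gr_map raddfB. Qed.

Lemma gr_mapU k : gr_map h (gr_of k) = gr_of (h k).
Proof. by rewrite /gr_map linextU. Qed.

Lemma gr_map_is_monoid_morphism : monoid_morphism (gr_map h).
Proof.
split=> [|x y]; first by rewrite gr_mapU ghom1.
move: x; apply: gr_ext => [x x'|x x'|k].
- by rewrite mulrBl gr_mapB.
- by rewrite gr_mapB mulrBl.
move: y; apply: gr_ext => [y y'|y y'|l].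
- by rewrite mulrBr gr_mapB.
- by rewrite gr_mapB mulrBr.
by rewrite -gr_ofM !gr_mapU ghomM gr_ofM.
Qed.

HB.instance Definition _ :=
  GRing.isZmodMorphism.Build (group_ring F) (group_ring H) (gr_map h) gr_mapB.
HB.instance Definition _ :=
  GRing.isMonoidMorphism.Build (group_ring F) (group_ring H) (gr_map h)
    gr_map_is_monoid_morphism.

End GrMap.

Lemma gr_map_id (F : group) (h : ghom F F) : h =1 id -> gr_map h =1 id.
Proof.
by move=> hE; apply: gr_ext => [x y|x y|k]; rewrite ?gr_mapB //
  gr_mapU hE.
Qed.

Lemma gr_map_comp (F H K : group) (k : ghom H K) (h : ghom F H)
    (l : ghom F K) :
  (forall x, l x = k (h x)) -> forall x, gr_map l x = gr_map k (gr_map h x).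
Proof.
move=> lE; apply: gr_ext => [x y|x y|a].
- by rewrite gr_mapB.
- by rewrite !gr_mapB.
by rewrite !gr_mapU lE.
Qed.

Lemma augmentationU (F : group) (k : F) : augmentation (gr_of k) = 1.
Proof. by rewrite /augmentation linextU. Qed.

Lemma augmentationB (F : group) : zmod_morphism (@augmentation F).
Proof. exact: raddfB. Qed.

Lemma augmentationM (F : group) : {morph @augmentation F : x y / x * y}.
Proof.
move=> x y; move: x; apply: gr_ext => [x x'|x x'|k].
- by rewrite mulrBl augmentationB.
- by rewrite augmentationB mulrBl.
move: y; apply: gr_ext => [y y'|y y'|l].
- by rewrite mulrBr augmentationB.
- by rewrite augmentationB mulrBr.
by rewrite -gr_ofM !augmentationU.
Qed.

Lemma augmentation_map (F H : group) (h : ghom F H) x :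
  augmentation (gr_map h x) = augmentation x.
Proof.
move: x; apply: gr_ext => [x y|x y|k].
- by rewrite gr_mapB augmentationB.
- by rewrite augmentationB.
by rewrite gr_mapU !augmentationU.
Qed.

Record ideal (R : nzRingType) : Type := Ideal {
  ideal_subgrp :> subgrp R;
  idealMl : forall a x, ideal_subgrp x -> ideal_subgrp (a * x);
  idealMr : forall a x, ideal_subgrp x -> ideal_subgrp (x * a)
}.

Section IdealOperations.
Variables (R : nzRingType) (I J : ideal R).

Definition ideal_prod_gen (z : R) : Prop :=
  exists x y, [/\ I x, J y & z = x * y].

Definition ideal_prod_subgrp : subgrp R := gen_subgrp ideal_prod_gen.

Lemma ideal_prod_ind (A : subgrp R) (z : R) :
  (forall x y, I x -> J y -> A (x * y)) -> ideal_prod_subgrp z -> A z.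
Proof. by move=> IJA; apply => _ [x [y [Ix Jy ->]]]; exact: IJA. Qed.

Lemma ideal_prodM x y : I x -> J y -> ideal_prod_subgrp (x * y).
Proof. by move=> Ix Jy A; apply; exists x, y. Qed.

Section Preimage.
Variables (S : nzRingType) (phi : {additive S -> R}) (A : subgrp R).

Lemma preim_mem0 : A (phi 0).
Proof. by rewrite raddf0; exact: smem0. Qed.

Lemma preim_memB x y : A (phi x) -> A (phi y) -> A (phi (x - y)).
Proof. by rewrite raddfB; exact: smemB. Qed.

Definition preim_subgrp : subgrp S := SubGrp preim_mem0 preim_memB.

End Preimage.

Lemma ideal_prod_Ml a z : ideal_prod_subgrp z -> ideal_prod_subgrp (a * z).
Proof.
move=> Hz; pose A := preim_subgrp
  (GRing.mull_fun a idfun : {additive R -> R}) ideal_prod_subgrp.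
apply: (@ideal_prod_ind A z _ Hz) => x y Ix Jy; rewrite /= mulrA.
by apply: ideal_prodM => //; exact: idealMl.
Qed.

Lemma ideal_prod_Mr a z : ideal_prod_subgrp z -> ideal_prod_subgrp (z * a).
Proof.
move=> Hz; pose A := preim_subgrp
  (GRing.mulr_fun a idfun : {additive R -> R}) ideal_prod_subgrp.
apply: (@ideal_prod_ind A z _ Hz) => x y Ix Jy; rewrite /= -mulrA.
by apply: ideal_prodM => //; exact: idealMr.
Qed.

Definition ideal_prod : ideal R := Ideal ideal_prod_Ml ideal_prod_Mr.

Definition ideal_sum_mem (z : R) : Prop :=
  exists x y, [/\ I x, J y & z = x + y].

Lemma ideal_sum_mem0 : ideal_sum_mem 0.
Proof. by exists 0, 0; split; [exact: smem0 | exact: smem0 | rewrite addr0]. Qed.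

Lemma ideal_sum_memB z z' :
  ideal_sum_mem z -> ideal_sum_mem z' -> ideal_sum_mem (z - z').
Proof.
move=> [x [y [Ix Jy ->]]] [x' [y' [Ix' Jy' ->]]].
exists (x - x'), (y - y'); split; try exact: smemB.
by rewrite opprD addrACA.
Qed.

Definition ideal_sum_subgrp : subgrp R := SubGrp ideal_sum_mem0 ideal_sum_memB.

Lemma ideal_sum_Ml a z : ideal_sum_subgrp z -> ideal_sum_subgrp (a * z).
Proof.
move=> [x [y [Ix Jy ->]]]; exists (a * x), (a * y).
by rewrite mulrDr; split=> //; exact: idealMl.
Qed.

Lemma ideal_sum_Mr a z : ideal_sum_subgrp z -> ideal_sum_subgrp (z * a).
Proof.
move=> [x [y [Ix Jy ->]]]; exists (x * a), (y * a).
by rewrite mulrDl; split=> //; exact: idealMr.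
Qed.

Definition ideal_sum : ideal R := Ideal ideal_sum_Ml ideal_sum_Mr.

Definition ideal_cap_subgrp : subgrp R :=
  @SubGrp R (fun z => I z /\ J z) (conj (smem0 I) (smem0 J))
    (fun z z' Hz Hz' => conj (smemB Hz.1 Hz'.1) (smemB Hz.2 Hz'.2)).

Definition ideal_cap : ideal R :=
  @Ideal R ideal_cap_subgrp
    (fun a z Hz => conj (idealMl a Hz.1) (idealMl a Hz.2))
    (fun a z Hz => conj (idealMr a Hz.1) (idealMr a Hz.2)).

End IdealOperations.

Definition aug_ideal (F : group) : ideal (group_ring F) :=
  @Ideal (group_ring F) (ker_subgrp (@augmentation F))
    (fun a x (x0 : augmentation x = 0) =>
       etrans (augmentationM a x) (etrans (congr1 _ x0) (mulr0 _)))
    (fun a x (x0 : augmentation x = 0) =>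
       etrans (augmentationM x a)
         (etrans (congr1 ( *%R^~ (augmentation a)) x0) (mul0r _))).

Definition ker_ideal (R S : nzRingType) (phi : {rmorphism R -> S}) : ideal R :=
  @Ideal R (ker_subgrp phi)
    (fun a x (x0 : phi x = 0) =>
       etrans (rmorphM phi a x) (etrans (congr1 _ x0) (mulr0 _)))
    (fun a x (x0 : phi x = 0) =>
       etrans (rmorphM phi x a) (etrans (congr1 ( *%R^~ (phi a)) x0) (mul0r _))).

Record presentation (G : group) : Type := Presentation {
  pgrp : group;
  pgrp_free : is_free pgrp;
  pmap : ghom pgrp G;
  pmap_epi : forall g, exists x, pmap x = g
}.

Record pres_hom (G : group) (c d : presentation G) : Type := PresHom {
  phom :> ghom (pgrp c) (pgrp d);
  phom_over : forall x, pmap d (phom x) = pmap c x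
}.

Section Pres.
Variable G : group.

Lemma pres_homP (c d : presentation G) (h k : pres_hom c d) :
  h =1 k -> h = k.
Proof.
case: h k => [h hG] [k kG] /= /ghomP E.
by case: k / E kG => kG; congr PresHom; exact: Prop_irrelevance.
Qed.

Definition pres_id (c : presentation G) : pres_hom c c :=
  @PresHom G c c (ghom_id (pgrp c)) (fun _ => erefl).

Definition pres_comp (a b c : presentation G) (k : pres_hom b c)
    (h : pres_hom a b) : pres_hom a c :=
  @PresHom G a c (ghom_comp k h)
    (fun x => etrans (phom_over k (h x)) (phom_over h x)).

Definition Pres : category :=
  @Category (presentation G) (@pres_hom G) pres_id pres_comp
    (fun a b h => @pres_homP a b (pres_comp (pres_id b) h) h (fun _ => erefl))
    (fun a b h => @pres_homP a b (pres_comp h (pres_id a)) h (fun _ => erefl))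
    (fun a b c d k h g => @pres_homP a d
       (pres_comp k (pres_comp h g)) (pres_comp (pres_comp k h) g)
       (fun _ => erefl)).

End Pres.

(* An ideal of Z[F] for every presentation F ->> G, preserved by all
   morphisms of presentations. *)
Record fideal (G : group) : Type := FIdeal {
  fideal_at :> forall c : presentation G, ideal (group_ring (pgrp c));
  fideal_map : forall (c d : presentation G) (h : pres_hom c d) x,
    fideal_at c x -> fideal_at d (gr_map h x)
}.

Declare Scope fideal_scope.
Delimit Scope fideal_scope with fid.
Bind Scope fideal_scope with fideal.

Section FIdealOperations.
Variable G : group.

Lemma aug_fideal_map (c d : presentation G) (h : pres_hom c d) x :
  aug_ideal (pgrp c) x -> aug_ideal (pgrp d) (gr_map h x).
Proof. by move=> /= x0; rewrite augmentation_map. Qed.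

Definition aug_fideal : fideal G := FIdeal aug_fideal_map.

Lemma rel_fideal_map (c d : presentation G) (h : pres_hom c d) x :
  ker_ideal (gr_map (pmap c)) x -> ker_ideal (gr_map (pmap d)) (gr_map h x).
Proof.
move=> /= x0; rewrite -(@gr_map_comp _ _ _ (pmap d) h (pmap c)) // => y.
by rewrite phom_over.
Qed.

Definition rel_fideal : fideal G :=
  FIdeal (fideal_at := fun c => ker_ideal (gr_map (pmap c))) rel_fideal_map.

Variables I J : fideal G.

Lemma fideal_prod_map (c d : presentation G) (h : pres_hom c d) x :
  ideal_prod (I c) (J c) x -> ideal_prod (I d) (J d) (gr_map h x).
Proof.
move=> Hx.
pose A := preim_subgrp (gr_map h : {additive _ -> _}) (ideal_prod (I d) (J d)).
apply: (@ideal_prod_ind _ (I c) (J c) A x _ Hx) => y z Iy Jz /=.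
by rewrite rmorphM; apply: ideal_prodM; exact: fideal_map.
Qed.

Definition fideal_prod : fideal G :=
  FIdeal (fideal_at := fun c => ideal_prod (I c) (J c)) fideal_prod_map.

Lemma fideal_sum_map (c d : presentation G) (h : pres_hom c d) x :
  ideal_sum (I c) (J c) x -> ideal_sum (I d) (J d) (gr_map h x).
Proof.
move=> [y [z [Iy Jz ->]]]; exists (gr_map h y), (gr_map h z).
by rewrite raddfD; split=> //; exact: fideal_map.
Qed.

Definition fideal_sum : fideal G :=
  FIdeal (fideal_at := fun c => ideal_sum (I c) (J c)) fideal_sum_map.

Lemma fideal_cap_map (c d : presentation G) (h : pres_hom c d) x :
  ideal_cap (I c) (J c) x -> ideal_cap (I d) (J d) (gr_map h x).
Proof. by move=> [Ix Jx]; split; exact: fideal_map. Qed.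

Definition fideal_cap : fideal G :=
  FIdeal (fideal_at := fun c => ideal_cap (I c) (J c)) fideal_cap_map.

End FIdealOperations.

Notation "I * J" := (fideal_prod I J) : fideal_scope.
Notation "I + J" := (fideal_sum I J) : fideal_scope.
Notation "I :&: J" := (fideal_cap I J) : fideal_scope.

Section FIdealFunctors.
Variables (G : group) (I J : fideal G).

Definition fideal_fmap (c d : Pres G) (h : hom c d) :
  {additive subgrp_type (I c) -> subgrp_type (I d)} :=
  subgrp_map (fun x => @fideal_map G I c d h x).

Lemma fideal_fmap_id (c : Pres G) (x : subgrp_type (I c)) :
  fideal_fmap (idm c) x = x.
Proof. by apply: val_inj; rewrite /= gr_map_id. Qed.

Lemma fideal_fmap_comp (a b c : Pres G) (k : hom b c) (h : hom a b)
    (x : subgrp_type (I a)) :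
  fideal_fmap (comp k h) x = fideal_fmap k (fideal_fmap h x).
Proof. by apply: val_inj; rewrite /= -(@gr_map_comp _ _ _ k h (ghom_comp k h)). Qed.

Definition fideal_functor : abfunctor (Pres G) :=
  @AbFunctor (Pres G) (fun c => subgrp_type (I c)) fideal_fmap
    fideal_fmap_id fideal_fmap_comp.

Definition fquot_fmap (c d : Pres G) (h : hom c d) :
  {additive subquot (I c) (J c) -> subquot (I d) (J d)} :=
  subquot_map (phi := gr_map h) (fun x => @fideal_map G I c d h x)
    (fun x => @fideal_map G J c d h x).

Lemma fquot_fmapE (c d : Pres G) (h : hom c d) (x : subgrp_type (I c)) :
  fquot_fmap h (subquot_class (J c) x) = subquot_class (J d) (fideal_fmap h x).
Proof. exact: subquot_mapE. Qed.

Lemma fquot_fmap_id (c : Pres G) (q : subquot (I c) (J c)) :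
  fquot_fmap (idm c) q = q.
Proof.
have [x ->] := subquot_classP q; by rewrite fquot_fmapE fideal_fmap_id.
Qed.

Lemma fquot_fmap_comp (a b c : Pres G) (k : hom b c) (h : hom a b)
    (q : subquot (I a) (J a)) :
  fquot_fmap (comp k h) q = fquot_fmap k (fquot_fmap h q).
Proof.
have [x ->] := subquot_classP q; by rewrite !fquot_fmapE fideal_fmap_comp.
Qed.

(* F ->> G is sent to I / (I ∩ J). *)
Definition fquot : abfunctor (Pres G) :=
  @AbFunctor (Pres G) (fun c => subquot (I c) (J c)) fquot_fmap
    fquot_fmap_id fquot_fmap_comp.

End FIdealFunctors.

Section FQuotientInclusion.
Variables (G : group) (I J I' J' : fideal G).
Hypothesis II' : forall c x, I c x -> I' c x.
Hypothesis JJ' : forall c x, J c x -> J' c x.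

Definition fquot_incl_at (c : Pres G) : {additive fquot I J c -> fquot I' J' c} :=
  subquot_map (phi := idfun) (fun x => @II' c x) (fun x => @JJ' c x).

Lemma fquot_incl_atE (c : Pres G) (x : subgrp_type (I c)) :
  fquot_incl_at c (subquot_class (J c) x) =
  subquot_class (J' c) (subgrp_mk (II' (subgrp_valP x))).
Proof. exact: subquot_mapE. Qed.

Lemma fquot_incl_natural (a b : Pres G) (h : hom a b) (q : fquot I J a) :
  fquot_incl_at b (fmap (fquot I J) h q) =
  fmap (fquot I' J') h (fquot_incl_at a q).
Proof.
have [x ->] := subquot_classP q.
rewrite [fmap _ _ _]fquot_fmapE !fquot_incl_atE [RHS]fquot_fmapE.
by congr subquot_class; exact: val_inj.
Qed.

(* The map I / (I ∩ J) -> I' / (I' ∩ J') induced by the inclusions of I in I'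
   and of J in J' *)
Definition fquot_incl : nattrans (fquot I J) (fquot I' J') :=
  NatTrans fquot_incl_natural.

End FQuotientInclusion.

Section Tensor.
Variables (R : nzRingType) (M N : zmodType).
Variables (ract : M -> R -> M) (lact : R -> N -> N).

Inductive tensor_rel : {malg int[(M * N)%type]} -> Prop :=
| tensor_rel_Dl m m' n :
    tensor_rel (<< (m + m', n) >> - (<< (m, n) >> + << (m', n) >>))
| tensor_rel_Dr m n n' :
    tensor_rel (<< (m, n + n') >> - (<< (m, n) >> + << (m, n') >>))
| tensor_rel_balanced m a n :
    tensor_rel (<< (ract m a, n) >> - << (m, lact a n) >>).

Definition tensor : Type := Quotient.quot (smemb (gen_subgrp tensor_rel)).

HB.instance Definition _ := Choice.on tensor.
HB.instance Definition _ := GRing.Zmodule.on tensor.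

Definition tens (m : M) (n : N) : tensor :=
  \pi_(Quotient.quot (smemb (gen_subgrp tensor_rel)))%qT << (m, n) >>.

End Tensor.

Section IdealTensor.
Variables (R : nzRingType) (I J : ideal R).

Definition ideal_ract (x : subgrp_type I) (a : R) : subgrp_type I :=
  subgrp_mk (idealMr a (subgrp_valP x)).

Definition ideal_lact (a : R) (y : subgrp_type J) : subgrp_type J :=
  subgrp_mk (idealMl a (subgrp_valP y)).

(* I ⊗_R J, with I as a right and J as a left R-module *)
Definition ideal_tensor : Type := tensor ideal_ract ideal_lact.

HB.instance Definition _ := GRing.Zmodule.on ideal_tensor.

Definition ideal_tens (x : subgrp_type I) (y : subgrp_type J) : ideal_tensor :=
  tens ideal_ract ideal_lact x y.

End IdealTensor.

Notation f_ := (@aug_fideal _).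
Notation r_ := (@rel_fideal _).

Section Codes.
Variable G : group.

Definition g2 : ideal (group_ring G) := ideal_prod (aug_ideal G) (aug_ideal G).

Definition ffr_rff : fideal G := (f_ * f_ * r_ + r_ * f_ * f_)%fid.

Lemma ff_map_g2 (c : presentation G) x :
  (f_ * f_)%fid c x -> g2 (gr_map (pmap c) x).
Proof.
move=> Hx; pose A := preim_subgrp (gr_map (pmap c) : {additive _ -> _}) g2.
apply: (@ideal_prod_ind _ (f_ c) (f_ c) A x _ Hx) => y z y0 z0.
by rewrite /A /= rmorphM; apply: ideal_prodM; rewrite /= augmentation_map.
Qed.

Lemma fff_of_ffM (c : presentation G) x y :
  (f_ * f_)%fid c x -> (f_ * f_)%fid c y -> (f_ * f_ * f_)%fid c (x * y).
Proof.
move=> Hx Hy; apply: ideal_prodM => //.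
pose A : subgrp _ := f_ c.
apply: (@ideal_prod_ind _ (f_ c) (f_ c) A y _ Hy) => u v _ v0.
exact: (idealMl (i := f_ c)).
Qed.

Lemma ffff_sub_fff (c : presentation G) x :
  (f_ * f_ * f_ * f_)%fid c x -> (f_ * f_ * f_)%fid c x.
Proof.
move=> Hx; pose A : subgrp _ := (f_ * f_ * f_)%fid c.
apply: (@ideal_prod_ind _ ((f_ * f_ * f_)%fid c) (f_ c) A x _ Hx) => u v Hu _.
exact: (idealMr (i := (f_ * f_ * f_)%fid c)).
Qed.

Lemma cap_ffff_sub (c : presentation G) x :
  (ffr_rff :&: f_ * f_ * f_ * f_)%fid c x -> ffr_rff c x.
Proof. by case. Qed.

(* ff / (r ∩ ff) -> g^2, induced by Z[F] ->> Z[G] *)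
Definition ff_to_g2_fun (c : Pres G)
    (q : fquot (f_ * f_)%fid (r_ :&: f_ * f_)%fid c) : subgrp_type g2 :=
  subgrp_map (@ff_map_g2 c) (repr q).

Lemma ff_to_g2E (c : Pres G) x :
  ff_to_g2_fun (subquot_class ((r_ :&: f_ * f_)%fid c) x : fquot _ _ c) =
  subgrp_map (@ff_map_g2 c) x.
Proof.
apply: val_inj => /=; apply/eqP; rewrite -subr_eq0 -raddfB; apply/eqP.
have: (r_ :&: f_ * f_)%fid c
  (val (repr (subquot_class ((r_ :&: f_ * f_)%fid c) x)) - val x).
  by apply/subquot_class_eq; rewrite /subquot_class reprK.
by case.
Qed.

Lemma ff_to_g2_is_additive (c : Pres G) : zmod_morphism (@ff_to_g2_fun c).
Proof.
move=> p q; have [x ->] := subquot_classP p; have [y ->] := subquot_classP q.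
by rewrite -raddfB !ff_to_g2E raddfB.
Qed.

HB.instance Definition _ (c : Pres G) :=
  GRing.isZmodMorphism.Build (fquot (f_ * f_)%fid (r_ :&: f_ * f_)%fid c)
    (subgrp_type g2) (@ff_to_g2_fun c) (@ff_to_g2_is_additive c).

Lemma ff_to_g2_natural (a b : Pres G) (h : hom a b)
    (q : fquot (f_ * f_)%fid (r_ :&: f_ * f_)%fid a) :
  ff_to_g2_fun (fmap (fquot _ _) h q) = ff_to_g2_fun q.
Proof.
have [x ->] := subquot_classP q; rewrite [fmap _ _ _]fquot_fmapE !ff_to_g2E.
apply: val_inj; rewrite /= -(@gr_map_comp _ _ _ (pmap b) h (pmap a)) // => y.
by rewrite phom_over.
Qed.

Definition ff_to_g2 :
  nattrans (fquot (f_ * f_)%fid (r_ :&: f_ * f_)%fid)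
    (const_functor (Pres G) (subgrp_type g2)) :=
  @NatTrans (Pres G) (fquot _ _) (const_functor _ (subgrp_type g2))
    (fun c => @ff_to_g2_fun c : {additive _ -> _}) ff_to_g2_natural.

(* The map ffff / ((ffr + rff) ∩ ffff) -> fff / (ffr + rff) induced by the
   inclusion of ffff in fff *)
Definition ffff_to_fff :
  nattrans (fquot (f_ * f_ * f_ * f_)%fid (ffr_rff :&: f_ * f_ * f_ * f_)%fid)
    (fquot (f_ * f_ * f_)%fid ffr_rff) :=
  fquot_incl ffff_sub_fff cap_ffff_sub.

End Codes.

Definition ab_injective (D : zmodType) : Prop :=
  forall (V W : zmodType) (j : {additive V -> W}) (f : {additive V -> D}),
  injective j -> exists g : {additive W -> D}, forall x, g (j x) = f x.

Lemma pairN (V W : zmodType) (a : V) (b : W) : - (a, b) = (- a, - b).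
Proof. by []. Qed.

Lemma pairB (V W : zmodType) (a a' : V) (b b' : W) :
  (a, b) - (a', b') = (a - a', b - b').
Proof. by []. Qed.

Section DivisibleInjective.
Variable D : zmodType.
Hypothesis divisible : forall (n : nat) (x : D), exists y, y *+ n.+1 = x.
Variables (V W : zmodType) (j : {additive V -> W}) (f : {additive V -> D}).
Hypothesis j_inj : injective j.

(* graphs of partial extensions of f *)
Definition partial_ext (X : W * D -> Prop) : Prop :=
  [/\ forall v, X (j v, f v),
      forall p q, X p -> X q -> X (p - q) &
      forall d, X (0, d) -> d = 0].

Lemma partial_ext_graph : partial_ext (fun p => exists v, p = (j v, f v)).
Proof.
split=> [v|p q [v ->] [v' ->]|d [v [j0 ->]]]; first by exists v.
  by exists (v - v'); rewrite !raddfB.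
by rewrite (j_inj (x1 := v) (x2 := 0)) ?raddf0.
Qed.

Lemma partial_ext_maximal : exists X, partial_ext X /\
  forall Y, partial_ext Y -> (forall p, X p -> Y p) -> forall p, Y p -> X p.
Proof.
pose P (X : classical_sets.set (W * D)) := (exists p, X p) -> partial_ext X.
have [|X [PX Xmax]] := @classical_sets.Zorn_bigcup _ P.
  move=> F FP Ftot [p0 [X0 FX0 X0p0]].
  have good X p : F X -> X p -> partial_ext X.
    by move=> FX Xp; apply: (FP _ FX); exists p.
  split=> [v|p q [X FX Xp] [Y FY Yq]|d [X FX Xd]].
  - by exists X0 => //; have [H _ _] := good _ _ FX0 X0p0.
  - have [XY|YX] := Ftot X Y FX FY.
      by exists Y => //; have [_ H _] := good _ _ FY Yq; apply: H => //; exact: XY.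
    by exists X => //; have [_ H _] := good _ _ FX Xp; apply: H => //; exact: YX.
  - by have [_ _] := good _ _ FX Xd; apply.
have Xne : exists p, X p.
  apply: contrapT => X0.
  apply: (Xmax _ _ (fun=> partial_ext_graph)); split=> [p Xp|H].
    by case: X0; exists p.
  by apply: X0; exists (j 0, f 0); apply: H; exists 0.
exists X; split=> [|Y extY XY p Yp]; first exact: PX.
apply: contrapT => nXp; apply: (Xmax Y) => //.
by split=> // YX; apply: nXp; exact: YX.
Qed.

Section Maximal.
Variable X : W * D -> Prop.
Hypothesis extX : partial_ext X.
Hypothesis X_max :
  forall Y, partial_ext Y -> (forall p, X p -> Y p) -> forall p, Y p -> X p.

Let XB p q : X p -> X q -> X (p - q). Proof. by case: extX => _ + _; apply. Qed.
Let X0 : X 0.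
Proof. by case: extX => + _ _ => /(_ 0) Xj; rewrite -(subrr (j 0, f 0)); exact: XB. Qed.
Let XN p : X p -> X (- p). Proof. by move=> Xp; rewrite -sub0r; exact: XB. Qed.
Let XD p q : X p -> X q -> X (p + q).
Proof. by move=> Xp Xq; rewrite -[q]opprK; apply: XB => //; exact: XN. Qed.
Let XMn p n : X p -> X (p *+ n).
Proof. by move=> Xp; elim: n => [|n IH] //; rewrite mulrS; exact: XD. Qed.
Let XMz p (n : int) : X p -> X (p *~ n).
Proof.
by move=> Xp; case: n => n; [exact: XMn | rewrite NegzE mulrNz; apply/XN/XMn].
Qed.
Let X_fun w d d' : X (w, d) -> X (w, d') -> d = d'.
Proof.
move=> Xd Xd'; apply/eqP; rewrite -subr_eq0; apply/eqP.
case: extX => _ _; apply; move: (XB Xd Xd').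
by rewrite pairB subrr.
Qed.

Lemma fst_mulrz (p : W * D) (k : int) : (p *~ k).1 = p.1 *~ k.
Proof. exact: (raddfMz (@fst W D) k p). Qed.

Lemma snd_mulrz (p : W * D) (k : int) : (p *~ k).2 = p.2 *~ k.
Proof. exact: (raddfMz (@snd W D) k p). Qed.

Lemma value_at w : exists d : D, forall (k : int) e, X (w *~ k, e) -> e = d *~ k.
Proof.
have [Hn|Hn] := pselect (exists n, exists e, X (w *+ n.+1, e)); last first.
  exists 0 => k e; case: k => [[|n]|n] Xk.
  - by rewrite mulr0z; apply: (X_fun (w := 0)).
  - by case: Hn; exists n, e.
  - by case: Hn; exists n, (- e); rewrite NegzE mulrNz in Xk;
      move: (XN Xk); rewrite pairN opprK.
have Hb : exists n, `[< exists e, X (w *+ n.+1, e) >].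
  by case: Hn => n Hn; exists n; apply/asboolP.
case: (ex_minnP Hb) => n /asboolP [e Xe] n_min.
have [d dE] := divisible n e; exists d => k e' Xk.
have kE := divz_eq k n.+1; set q := (k %/ n.+1)%Z in kE.
have r0 : (k %% n.+1)%Z = 0.
  case r: (k %% n.+1)%Z => [[|m]|m] //.
    have mn : (m < n)%N.
      by have := @ltz_pmod k n.+1 isT; rewrite r.
    have Xm : X (w *+ m.+1, e' - e *~ q).
      have := XB Xk (XMz q Xe).
      rewrite [(w *+ n.+1, e) *~ q]surjective_pairing fst_mulrz snd_mulrz /=.
      rewrite pairB {1}kE r mulrzDr mulrzA.
      by rewrite [w *+ n.+1]pmulrn [_ *~ _ *~ q]mulrzAC addrAC subrr add0r.
    have /n_min : `[< exists e, X (w *+ m.+1, e) >].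
      by apply/asboolP; exists (e' - e *~ q).
    by rewrite leqNgt mn.
  by have := @modz_ge0 k n.+1 isT; rewrite r.
rewrite r0 addr0 in kE.
apply: (X_fun Xk); rewrite kE.
have := XMz q Xe.
rewrite [(w *+ n.+1, e) *~ q]surjective_pairing fst_mulrz snd_mulrz /=.
by rewrite -dE !pmulrn !mulrzA ![_ *~ _ *~ q]mulrzAC.
Qed.

Lemma maximal_total w : exists d, X (w, d).
Proof.
have [d dE] := value_at w; exists d.
pose Y (p : W * D) := exists q (k : int), X q /\ p = q + (w, d) *~ k.
apply: (X_max (Y := Y)).
- split=> [v|p p' [q [k [Xq ->]]] [q' [k' [Xq' ->]]]|e [q [k [Xq E]]]].
  + exists (j v, f v), 0; rewrite mulr0z addr0; split=> //.
    by case: extX.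
  + exists (q - q'), (k - k'); split; first exact: XB.
    by rewrite mulrzBr opprD addrACA.
  + have qE : q = (w *~ - k, e + d *~ - k).
      have -> : q = (0, e) - (w, d) *~ k by rewrite E addrK.
      rewrite [(w, d) *~ k]surjective_pairing fst_mulrz snd_mulrz /=.
      by rewrite pairB sub0r !mulrNz.
    rewrite qE in Xq; have := dE _ _ Xq.
    by move/eqP; rewrite -subr_eq0 addrK => /eqP.
- by move=> p Xp; exists p, 0; rewrite mulr0z addr0.
- by exists 0, 1; rewrite add0r mulr1z.
Qed.

Lemma maximal_extension : exists g : {additive W -> D}, forall x, g (j x) = f x.
Proof.
pose g w := projT1 (cid (maximal_total w)).
have gP w : X (w, g w) := projT2 (cid (maximal_total w)).
have gB : zmod_morphism g.
  move=> x y; apply: (X_fun (gP _)).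
  by have := XB (gP x) (gP y).
pose gA := GRing.isZmodMorphism.Build _ _ g gB.
exists (HB.pack g gA : {additive W -> D}) => x /=.
by apply: (X_fun (gP _)); case: extX.
Qed.

End Maximal.

Lemma divisible_extension : exists g : {additive W -> D}, forall x, g (j x) = f x.
Proof.
by have [X [extX X_max]] := partial_ext_maximal; exact: (maximal_extension extX).
Qed.

End DivisibleInjective.

Section DivisibleHull.
Variable A : zmodType.

Definition hull_in (x : {malg int[A]}) : {malg rat[A]} :=
  linext (fun a : A => << (1 : rat) *g a >>) x.

Lemma hull_inE x a : (hull_in x)@_a = (x@_a)%:~R.
Proof.
rewrite /hull_in /linext raddf_sum /= [in RHS](monalgE x) raddf_sum raddf_sum /=.
apply: eq_bigr => k _; rewrite raddfMz /= !mcoeffU.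
by case: (k == a); rewrite ?mulr1n ?mulr0n ?mul0rz.
Qed.

Lemma hull_in_inj x : hull_in x = 0 -> x = 0.
Proof.
move=> x0; apply/malgP => a; apply: (@intr_inj rat).
by rewrite -hull_inE x0 !mcoeff0.
Qed.

Lemma hull_inB : zmod_morphism hull_in.
Proof. by move=> x y; rewrite /hull_in raddfB. Qed.

Definition hull_rel_mem (y : {malg rat[A]}) : Prop :=
  exists2 x : {malg int[A]}, linext id x = 0 & hull_in x = y.

Lemma hull_rel_mem0 : hull_rel_mem 0.
Proof. by exists 0; rewrite /hull_in raddf0. Qed.

Lemma hull_rel_memB y z :
  hull_rel_mem y -> hull_rel_mem z -> hull_rel_mem (y - z).
Proof.
move=> [x x0 <-] [x' x'0 <-]; exists (x - x'); last exact: hull_inB.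
by rewrite raddfB /= x0 x'0 subrr.
Qed.

Definition hull_rel : subgrp {malg rat[A]} := SubGrp hull_rel_mem0 hull_rel_memB.

Definition hull : zmodType := Quotient.quot (smemb hull_rel).

Definition hull_unit (a : A) : hull :=
  \pi_(Quotient.quot (smemb hull_rel))%qT << (1 : rat) *g a >>.

Lemma hull_pi_eq (y z : {malg rat[A]}) :
  \pi_(Quotient.quot (smemb hull_rel))%qT y =
  \pi_(Quotient.quot (smemb hull_rel))%qT z <-> hull_rel (y - z).
Proof.
split=> [/eqP|H]; first by rewrite -Quotient.idealrBE => /smembP.
by apply/eqP; rewrite -Quotient.idealrBE; apply/smembP.
Qed.

Lemma hull_inU (a : A) : hull_in << a >> = << (1 : rat) *g a >>.
Proof. by rewrite /hull_in linextU mulr1z. Qed.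

Lemma hull_unitB : zmod_morphism hull_unit.
Proof.
move=> a b; rewrite /hull_unit -raddfB; apply/hull_pi_eq.
exists (<< a - b >> - (<< a >> - << b >>)).
  by rewrite !raddfB /= !linextU !mulr1z -opprD subrr.
by rewrite !hull_inB !hull_inU.
Qed.

HB.instance Definition _ :=
  GRing.isZmodMorphism.Build A hull hull_unit hull_unitB.

Lemma hull_unit_inj : injective hull_unit.
Proof.
move=> a b /hull_pi_eq [x x0]; rewrite -!hull_inU -hull_inB => /eqP.
rewrite -subr_eq0 -hull_inB => /eqP/hull_in_inj/eqP; rewrite subr_eq0 => /eqP xE.
move: x0; rewrite xE raddfB /= !linextU !mulr1z => /eqP.
by rewrite subr_eq0 => /eqP.
Qed.

Lemma hull_divisible (n : nat) (x : hull) : exists y, y *+ n.+1 = x.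
Proof.
exists (\pi_(Quotient.quot (smemb hull_rel))%qT (n.+1%:R^-1 *: repr x)).
rewrite -raddfMn -scaler_nat scalerA mulfV ?scale1r.
  exact: reprK.
by rewrite Num.Theory.pnatr_eq0.
Qed.

Lemma hull_injective : ab_injective hull.
Proof. by move=> V W j f j_inj; exact: (divisible_extension hull_divisible). Qed.

End DivisibleHull.

Section Coinduced.
Variables (C : category) (M : C -> zmodType).

Definition coind_at (c : C) : Type := forall d : C, hom c d -> M d.

Section At.
Variable c : C.
Implicit Types x y z : coind_at c.

HB.instance Definition _ := gen_eqMixin (coind_at c).
HB.instance Definition _ := gen_choiceMixin (coind_at c).

Lemma coindP x y : (forall d h, x d h = y d h) -> x = y.
Proof.
by move=> xy; apply: functional_extensionality_dep => d; apply/funext => h.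
Qed.

Definition coind_add x y : coind_at c := fun d h => x d h + y d h.
Definition coind_opp x : coind_at c := fun d h => - x d h.
Definition coind_zero : coind_at c := fun d h => 0.

Lemma coind_addA : associative coind_add.
Proof. by move=> x y z; apply: coindP => d h; rewrite /coind_add addrA. Qed.
Lemma coind_addC : commutative coind_add.
Proof. by move=> x y; apply: coindP => d h; rewrite /coind_add addrC. Qed.
Lemma coind_add0 : left_id coind_zero coind_add.
Proof. by move=> x; apply: coindP => d h; rewrite /coind_add add0r. Qed.
Lemma coind_addN : left_inverse coind_zero coind_opp coind_add.
Proof. by move=> x; apply: coindP => d h; rewrite /coind_add addNr. Qed.

HB.instance Definition _ :=
  GRing.isZmodule.Build (coind_at c)
    coind_addA coind_addC coind_add0 coind_addN.

End At.

Definition coind_fun (a b : C) (h : hom a b) (x : coind_at a) : coind_at b :=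
  fun d k => x d (comp k h).

Lemma coind_funB (a b : C) (h : hom a b) : zmod_morphism (coind_fun h).
Proof. by []. Qed.

HB.instance Definition _ (a b : C) (h : hom a b) :=
  GRing.isZmodMorphism.Build (coind_at a) (coind_at b) (coind_fun h)
    (coind_funB h).

Lemma coind_fun_id (a : C) (x : coind_at a) : coind_fun (idm a) x = x.
Proof. by apply: coindP => d k; rewrite /coind_fun compm1. Qed.

Lemma coind_fun_comp (a b c : C) (k : hom b c) (h : hom a b) (x : coind_at a) :
  coind_fun (comp k h) x = coind_fun k (coind_fun h x).
Proof. by apply: coindP => d l; rewrite /coind_fun compA. Qed.

Definition coind : abfunctor C :=
  @AbFunctor C coind_at (fun a b h => coind_fun h : {additive _ -> _})
    coind_fun_id coind_fun_comp.

Section ToCoinduced.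
Variables (A : abfunctor C) (m : forall d, {additive A d -> M d}).

Definition to_coind_fun (c : C) (x : A c) : coind_at c :=
  fun d h => m d (fmap A h x).

Lemma to_coind_funB c : zmod_morphism (@to_coind_fun c).
Proof. by move=> x y; apply: coindP => d h; rewrite /to_coind_fun !raddfB. Qed.

HB.instance Definition _ c :=
  GRing.isZmodMorphism.Build (A c) (coind_at c) (@to_coind_fun c)
    (@to_coind_funB c).

Lemma to_coind_natural (a b : C) (h : hom a b) (x : A a) :
  to_coind_fun (fmap A h x) = fmap coind h (to_coind_fun x).
Proof.
by apply: coindP => d k; rewrite /to_coind_fun /= /coind_fun fmap_comp.
Qed.

Definition to_coind : nattrans A coind :=
  @NatTrans C A coind (fun c => @to_coind_fun c : {additive _ -> _})
    to_coind_natural.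

End ToCoinduced.

Lemma coind_injective : (forall d, ab_injective (M d)) -> injective_object coind.
Proof.
move=> Minj A B j f j_inj.
have ext (d : C) : exists g : {additive B d -> M d},
    forall x, g (j d x) = (f d x : coind_at d) d (idm d).
  have fB : zmod_morphism (fun x => (f d x : coind_at d) d (idm d)).
    by move=> x y; rewrite raddfB.
  pose fA := GRing.isZmodMorphism.Build _ _ _ fB.
  have [g gE] := Minj d _ _ (j d) (HB.pack (fun x => (f d x : coind_at d) d (idm d)) fA
    : {additive A d -> M d}) (@j_inj d).
  by exists g.
pose m d := projT1 (cid (ext d)); exists (to_coind m) => c x.
apply: coindP => d h; rewrite /= /to_coind_fun -ntmapE (projT2 (cid (ext d))).
by rewrite ntmapE /= /coind_fun comp1m.
Qed.

End Coinduced.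

Section Cokernel.
Variables (C : category) (A B : abfunctor C) (t : nattrans A B).

Definition coker_at (c : C) : zmodType := Quotient.quot (smemb (im_subgrp (t c))).

Definition coker_pi (c : C) : {additive B c -> coker_at c} :=
  \pi_(Quotient.quot (smemb (im_subgrp (t c))))%qT.

Lemma coker_pi_eq c x y :
  coker_pi c x = coker_pi c y <-> exists z, t c z = x - y.
Proof.
split=> [/eqP|H]; first by rewrite /coker_pi -Quotient.idealrBE => /smembP.
by apply/eqP; rewrite /coker_pi -Quotient.idealrBE; apply/smembP.
Qed.

Lemma coker_piP c q : exists x, q = coker_pi c x.
Proof. by exists (repr q); rewrite /coker_pi /= reprK. Qed.

Definition coker_fun (a b : C) (h : hom a b) (q : coker_at a) : coker_at b :=
  coker_pi b (fmap B h (repr q)).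

Lemma coker_funE (a b : C) (h : hom a b) x :
  coker_fun h (coker_pi a x) = coker_pi b (fmap B h x).
Proof.
apply/coker_pi_eq; rewrite -raddfB.
have /coker_pi_eq [z <-] : coker_pi a (repr (coker_pi a x)) = coker_pi a x.
  by rewrite /coker_pi /= reprK.
by exists (fmap A h z); rewrite ntmapE.
Qed.

Lemma coker_funB (a b : C) (h : hom a b) : zmod_morphism (coker_fun h).
Proof.
move=> p q; have [x ->] := coker_piP p; have [y ->] := coker_piP q.
by rewrite -raddfB !coker_funE !raddfB.
Qed.

HB.instance Definition _ (a b : C) (h : hom a b) :=
  GRing.isZmodMorphism.Build (coker_at a) (coker_at b) (coker_fun h)
    (coker_funB h).

Lemma coker_fun_id (a : C) (q : coker_at a) : coker_fun (idm a) q = q.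
Proof. by have [x ->] := coker_piP q; rewrite coker_funE fmap_id. Qed.

Lemma coker_fun_comp (a b c : C) (k : hom b c) (h : hom a b) (q : coker_at a) :
  coker_fun (comp k h) q = coker_fun k (coker_fun h q).
Proof. by have [x ->] := coker_piP q; rewrite !coker_funE fmap_comp. Qed.

Definition coker : abfunctor C :=
  @AbFunctor C coker_at (fun a b h => coker_fun h : {additive _ -> _})
    coker_fun_id coker_fun_comp.

Definition to_coker : nattrans B coker :=
  @NatTrans C B coker coker_pi (fun a b h x => esym (coker_funE h x)).

End Cokernel.

Lemma comp_natural (C : category) (A B D : abfunctor C) (u : nattrans B D)
    (t : nattrans A B) (a b : C) (h : hom a b) (x : A a) :
  u b (t b (fmap A h x)) = fmap D h (u a (t a x)).
Proof. by rewrite !ntmapE. Qed.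

Definition nt_comp (C : category) (A B D : abfunctor C) (u : nattrans B D)
    (t : nattrans A B) : nattrans A D :=
  @NatTrans C A D (fun c => u c \o t c : {additive _ -> _})
    (@comp_natural C A B D u t).

Section Resolution.
Variables (C : category).

Definition inj_hull (A : abfunctor C) : abfunctor C := coind (fun d => hull (A d)).

Definition inj_hull_in (A : abfunctor C) : nattrans A (inj_hull A) :=
  to_coind (fun d => @hull_unit (A d) : {additive _ -> _}).

Lemma inj_hull_injective (A : abfunctor C) : injective_object (inj_hull A).
Proof. by apply: coind_injective => d; exact: hull_injective. Qed.

Lemma inj_hull_in_mono (A : abfunctor C) c : injective (inj_hull_in A c).
Proof.
move=> x y /(congr1 (fun u : coind_at (fun d => hull (A d)) c => u c (idm c))).
by rewrite /= /to_coind_fun !fmap_id => /hull_unit_inj.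
Qed.

Definition next_cosyzygy (A : abfunctor C) : abfunctor C := coker (inj_hull_in A).

Definition std_diff (A : abfunctor C) :
  nattrans (inj_hull A) (inj_hull (next_cosyzygy A)) :=
  nt_comp (inj_hull_in (next_cosyzygy A)) (to_coker (inj_hull_in A)).

Lemma std_diff_eq0 (A : abfunctor C) c x :
  std_diff A c x = 0 <-> exists y, inj_hull_in A c y = x.
Proof.
have -> : std_diff A c x =
  inj_hull_in (next_cosyzygy A) c (coker_pi (inj_hull_in A) c x) by [].
move: (@inj_hull_in_mono (next_cosyzygy A) c).
move: (inj_hull_in (next_cosyzygy A) c) => /= u u_inj.
have E0 : coker_pi (inj_hull_in A) c x = 0 <-> exists y, inj_hull_in A c y = x.
  rewrite -[X in _ = X <-> _](raddf0 (coker_pi (inj_hull_in A) c)).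
  by rewrite coker_pi_eq subr0.
split=> [|/E0 ->]; last exact: raddf0.
by rewrite -[X in _ = X -> _](raddf0 u) => /u_inj /E0.
Qed.

Lemma std_diff_exact (A : abfunctor C) c x :
  std_diff (next_cosyzygy A) c x = 0 <-> exists y, std_diff A c y = x.
Proof.
rewrite std_diff_eq0; split=> [[q <-]|[y <-]]; last first.
  by exists (coker_pi (inj_hull_in A) c y).
by have [y ->] := coker_piP q; exists y.
Qed.

Variable A : abfunctor C.

Definition cosyzygy (n : nat) : abfunctor C := iter n next_cosyzygy A.

(* In particular every functor has an injective resolution. *)
Definition std_resolution : injective_resolution A :=
  @InjectiveResolution C A (fun n => inj_hull (cosyzygy n))
    (fun n => std_diff (cosyzygy n))
    (inj_hull_in A) (fun n => @inj_hull_injective (cosyzygy n))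
    (@inj_hull_in_mono A) (@std_diff_eq0 A)
    (fun n => @std_diff_exact (cosyzygy n)).

End Resolution.

(* Main.v *)
Require Import Defs.
From HB Require Import structures.
From mathcomp Require Import all_boot all_order all_algebra.
From mathcomp Require Import boolp finmap monalg.

Set Implicit Arguments.
Unset Strict Implicit.
Unset Printing Implicit Defensive.

Import GRing.Theory Defs.
Local Open Scope ring_scope.

(** Write S = ffr + rff, W = S + ffff, Q = ffff / (S :&: ffff) and let U denote
    the functor fff / W.

    Q is constant: every element of ffff is a sum of products ab with a, b in
    ff, and modulo S such a product depends only on the classes of a and b
    modulo r, because ff.r and r.ff are contained in S.  Hence Q is the image of
    a transformation [mu] from the constant functor g^2 (x) g^2.  So two parallel
    morphisms of presentations act in the same way on Q ([Q_rigid]), and as any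
    two presentations are connected by morphisms in both directions, Q is
    constant ([rigid_constant]).

    For the limits one uses the exact sequences

      0 -> S -> W -> W / S -> 0,  0 -> W -> fff -> U -> 0,  with W / S = Q.

    All lim^i of fff and of U vanish, hence all lim^i of W vanish
    ([ses_lim_trivial]), and dimension shifting ([shift_iso], [shift_vanishing])
    gives lim^(i+1) S = lim^i Q; a constant functor has lim^0 = itself and no
    higher limits.

    The vanishing criterion is [retract_lim_trivial].  Fix a presentation c0 and
    let (shift A) c = A (c + c0), with + the coproduct of presentations, the free
    product of free groups.  The cochain complex lim (shift I) of an injective
    resolution I is the complex I c0, hence exact in positive degrees.
    So if the natural map A -> shift A has a natural retraction, then A has no
    higher limits; and lim A = 0 if this retraction kills A c0.

    For fff the retraction comes from the group homomorphism [kill] that sends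
    the second free factor to 1; it is not a morphism over G, but fff does not
    depend on the projection to G.  U is isomorphic to
    G_ab (x) F_ab (x) G_ab, and its retraction is kill on the middle factor only
    ([middle_map]): xyz |-> fold(x) kill(y) fold(z), where fold is a morphism
    over G.  That this is well defined on fff rests on the freeness of the
    group ([triple_product_map]): a free group P maps to unipotent 4 x 4 matrices
    over Z[F] with prescribed superdiagonals on a basis, and for x, y, z in the
    augmentation ideal the upper right corner of the image of xyz is the product
    of the three superdiagonal entries. *)

(** * Abelian functors: direct sums and extension into injectives *)

Section AdditiveOf.
Variables (V W : zmodType) (f : V -> W) (fB : zmod_morphism f).

(** The proof of additivity is an argument so that the instance below can be
    found by unification. *)
Definition additive_fun of zmod_morphism f := f.

HB.instance Definition _ :=
  GRing.isZmodMorphism.Build V W (additive_fun fB) fB.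

Definition additive_of : {additive V -> W} := additive_fun fB.

End AdditiveOf.

Section NatTransOf.
Variables (C : category) (A B : abfunctor C) (t : forall c, A c -> B c).
Hypothesis tB : forall c, zmod_morphism (@t c).
Hypothesis tE : forall a b (h : hom a b) x, @t b (fmap A h x) = fmap B h (@t a x).

Definition nattrans_of : nattrans A B :=
  @NatTrans C A B (fun c => additive_of (@tB c)) tE.

End NatTransOf.

Section DirectSum.
Variables (C : category) (A B : abfunctor C).

Definition dsum_fun (a b : C) (h : hom a b) (p : A a * B a) : A b * B b :=
  (fmap A h p.1, fmap B h p.2).

Lemma dsum_funB (a b : C) (h : hom a b) : zmod_morphism (dsum_fun h).
Proof. by case=> [x y] [x' y']; rewrite /dsum_fun /= !raddfB. Qed.

Lemma dsum_fun_id a p : @dsum_fun a a (idm a) p = p.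
Proof. by case: p => x y; rewrite /dsum_fun !fmap_id. Qed.

Lemma dsum_fun_comp (a b c : C) (k : hom b c) (h : hom a b) p :
  dsum_fun (comp k h) p = dsum_fun k (dsum_fun h p).
Proof. by rewrite /dsum_fun !fmap_comp. Qed.

Definition dsum : abfunctor C :=
  @AbFunctor C (fun c => (A c * B c)%type)
    (fun a b h => additive_of (dsum_funB h)) dsum_fun_id dsum_fun_comp.

Definition copair (D : abfunctor C) (u : nattrans A D) (v : nattrans B D) :
  nattrans dsum D.
Proof.
apply: (@nattrans_of C dsum D (fun c p => u c p.1 + v c p.2)).
- by move=> c [x y] [x' y'] /=; rewrite !raddfB addrACA opprD.
- by move=> a b h [x y] /=; rewrite !ntmapE raddfD.
Defined.

Definition pairing (D : abfunctor C) (u : nattrans D A) (v : nattrans D B) :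
  nattrans D dsum.
Proof.
apply: (@nattrans_of C D dsum (fun c x => (u c x, v c x))).
- by move=> c x y; rewrite !raddfB.
- by move=> a b h x; rewrite !ntmapE.
Defined.

Definition dsum_fst : nattrans dsum A.
Proof. by apply: (@nattrans_of C dsum A (fun c p => p.1)). Defined.

Definition dsum_snd : nattrans dsum B.
Proof. by apply: (@nattrans_of C dsum B (fun c p => p.2)). Defined.

Lemma dsum_injective :
  injective_object A -> injective_object B -> injective_object dsum.
Proof.
move=> Ainj Binj X Y j f j_inj.
have [g gE] := Ainj _ _ _ (nt_comp dsum_fst f) j_inj.
have [g' g'E] := Binj _ _ _ (nt_comp dsum_snd f) j_inj.
exists (pairing g g') => c x.
by rewrite [RHS]surjective_pairing; congr pair; [exact: gE | exact: g'E].
Qed.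

End DirectSum.

Definition nt_opp (C : category) (A B : abfunctor C) (t : nattrans A B) :
  nattrans A B.
Proof.
apply: (@nattrans_of C A B (fun c x => - t c x)) => [c x y|a b h x].
- by rewrite raddfB opprD.
- by rewrite ntmapE raddfN.
Defined.

(** Extension along a transformation that need not be mono: u factors through
    the image of t, which embeds into B. *)
Lemma injective_object_ext (C : category) (A B I : abfunctor C)
    (t : nattrans A B) (u : nattrans A I) :
  injective_object I -> (forall c x, t c x = 0 -> u c x = 0) ->
  exists g : nattrans B I, forall c x, g c (t c x) = u c x.
Proof.
move=> Iinj tu.
have pre c (y : image_functor t c) : exists x, t c x = val y.
  exact: (subgrp_valP y).
pose v c (y : image_functor t c) := u c (projT1 (cid (pre c y))).
have vE c (y : image_functor t c) x : t c x = val y -> v c y = u c x.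
  move=> xy; apply/eqP; rewrite -subr_eq0 -raddfB; apply/eqP/tu.
  by rewrite raddfB xy (projT2 (cid (pre c y))) subrr.
have vB c : zmod_morphism (v c).
  move=> y y'; have [x xE] := pre c y; have [x' x'E] := pre c y'.
  rewrite (vE _ _ _ xE) (vE _ _ _ x'E) (vE _ _ (x - x')) ?raddfB //=.
  by rewrite xE x'E.
have vN a b (h : hom a b) y : v b (fmap (image_functor t) h y) = fmap I h (v a y).
  have [x xE] := pre a y; rewrite (vE _ _ _ xE) (vE _ _ (fmap A h x)) ?ntmapE //=.
  by rewrite xE.
have jB c : zmod_morphism (fun y : image_functor t c => val y) by [].
pose j : nattrans (image_functor t) B := nattrans_of jB (fun _ _ _ _ => erefl).
have [c y y' /val_inj //|g gE] := Iinj _ _ j (nattrans_of vB vN).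
exists g => c x.
have tx : im_subgrp (t c) (t c x) by exists x.
have := gE c (subgrp_mk tx).
by rewrite [j c _]/= /additive_fun /= => ->; apply: vE.
Qed.

(** * Limits and their derived functors, in terms of elements *)

Section LimElements.
Variable C : category.
Implicit Types A B : abfunctor C.

Lemma lim_eq0 A (z : lim A) : z = 0 <-> forall c, z c = 0.
Proof. by split=> [-> // | z0]; apply: limP. Qed.

Lemma lim_map_eq0 A B (t : nattrans A B) (z : lim A) :
  lim_map t z = 0 <-> forall c, t c (z c) = 0.
Proof. exact: lim_eq0. Qed.

Lemma lim_map_eq A B (t : nattrans A B) (y : lim A) (z : lim B) :
  lim_map t y = z <-> forall c, t c (y c) = z c.
Proof. by split=> [<- //|yz]; apply: limP. Qed.

Lemma lim_lift A B (t : nattrans A B) (z : lim B) :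
  (forall c, injective (t c)) -> (forall c, exists x, t c x = z c) ->
  exists y, lim_map t y = z.
Proof.
move=> t_inj zP; pose y c := projT1 (cid (zP c)).
have yE c : t c (y c) = z c := projT2 (cid (zP c)).
have yC : compatible y.
  by move=> a b h; apply: t_inj; rewrite ntmapE !yE lim_valP.
by exists (Lim yC); apply/lim_map_eq.
Qed.

Variables (A : abfunctor C) (I : injective_resolution A).

Lemma ires_dK n c x : ires_d I n.+1 c (ires_d I n c x) = 0.
Proof. by apply/ires_exact; exists x. Qed.

Lemma ires_d_aug c x : ires_d I 0 c (ires_aug I c x) = 0.
Proof. by apply/ires_exact0; exists x. Qed.

Lemma limi0_eq0 :
  (forall x : limi I 0, x = 0) <->
  forall z : lim (ires_ob I 0), lim_map (ires_d I 0) z = 0 -> z = 0.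
Proof.
split=> [I0 z zd|I0 q].
  have := I0 (scls (zero_subgrp _) (zd : ker_subgrp (lim_map (ires_d I 0)) z)).
  rewrite -(raddf0 (subquot_class (zero_subgrp _))).
  by move=> /subquot_class_eq /=; rewrite subr0.
have [x ->] := subquot_classP q.
rewrite -(raddf0 (subquot_class _)); apply/subquot_class_eq => /=.
by rewrite subr0; apply/I0/(subgrp_valP x).
Qed.

Lemma limiS_eq0 n :
  (forall x : limi I n.+1, x = 0) <->
  forall z : lim (ires_ob I n.+1), lim_map (ires_d I n.+1) z = 0 ->
  exists y, lim_map (ires_d I n) y = z.
Proof.
split=> [I0 z zd|I0 q].
  have := I0 (scls (im_subgrp (lim_map (ires_d I n)))
                (zd : ker_subgrp (lim_map (ires_d I n.+1)) z)).
  rewrite -(raddf0 (subquot_class (im_subgrp _))).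
  by move=> /subquot_class_eq /=; rewrite subr0.
have [x ->] := subquot_classP q.
rewrite -(raddf0 (subquot_class _)); apply/subquot_class_eq => /=.
by rewrite subr0; apply/I0/(subgrp_valP x).
Qed.

Lemma lim0_limi0 : (forall x : lim A, x = 0) -> forall x : limi I 0, x = 0.
Proof.
move=> A0; apply/limi0_eq0 => z /lim_map_eq0 zd.
have [y <-] := @lim_lift _ _ (ires_aug I) z (@ires_aug_mono _ _ I)
  (fun c => proj1 (@ires_exact0 _ _ I c _) (zd c)).
by rewrite (A0 y) raddf0.
Qed.

End LimElements.

(** With the quantification over all resolutions the hypothesis applies to a
    resolution adapted to a given exact sequence, the horseshoe below. *)
Definition lim_trivial (C : category) (A : abfunctor C) : Prop :=
  forall (I : injective_resolution A) n (x : limi I n), x = 0.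

(** * Vanishing of higher limits by retraction from a shift *)

Section CoproductWith.
Variables (C : category) (c0 : C) (s : C -> C).
Variables (inl_ : forall c, hom c (s c)) (inr_ : forall c, hom c0 (s c)).
Variable cop : forall a b, hom a b -> hom c0 b -> hom (s a) b.
Hypothesis cop_inl : forall a b (h : hom a b) k, comp (cop h k) (inl_ a) = h.
Hypothesis cop_inr : forall a b (h : hom a b) k, comp (cop h k) (inr_ a) = k.
Hypothesis cop_eq : forall a b (f g : hom (s a) b),
  comp f (inl_ a) = comp g (inl_ a) -> comp f (inr_ a) = comp g (inr_ a) -> f = g.
Hypothesis from_c0 : forall c, inhabited (hom c0 c).

(** The coproduct h + id of morphisms. *)
Definition shift_hom (a b : C) (h : hom a b) : hom (s a) (s b) :=
  cop (comp (inl_ b) h) (inr_ b).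

Lemma shift_hom_inl a b (h : hom a b) :
  comp (shift_hom h) (inl_ a) = comp (inl_ b) h.
Proof. exact: cop_inl. Qed.

Lemma shift_hom_inr a b (h : hom a b) : comp (shift_hom h) (inr_ a) = inr_ b.
Proof. exact: cop_inr. Qed.

Lemma shift_hom_id a : shift_hom (idm a) = idm (s a).
Proof.
by apply: cop_eq; rewrite ?shift_hom_inl ?shift_hom_inr ?compm1 ?comp1m.
Qed.

Lemma shift_hom_comp a b c (k : hom b c) (h : hom a b) :
  shift_hom (comp k h) = comp (shift_hom k) (shift_hom h).
Proof.
by apply: cop_eq; rewrite -!compA ?shift_hom_inl ?shift_hom_inr //
  [in RHS]compA shift_hom_inl compA.
Qed.

Section Shift.
Variable A : abfunctor C.

Lemma shift_fmap_id (a : C) (x : A (s a)) : fmap A (shift_hom (idm a)) x = x.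
Proof. by rewrite shift_hom_id fmap_id. Qed.

Lemma shift_fmap_comp (a b c : C) (k : hom b c) (h : hom a b) (x : A (s a)) :
  fmap A (shift_hom (comp k h)) x =
  fmap A (shift_hom k) (fmap A (shift_hom h) x).
Proof. by rewrite shift_hom_comp fmap_comp. Qed.

Definition shift : abfunctor C :=
  @AbFunctor C (fun c => A (s c)) (fun a b h => fmap A (shift_hom h))
    shift_fmap_id shift_fmap_comp.

Lemma to_shift_natural (a b : C) (h : hom a b) (x : A a) :
  fmap A (inl_ b) (fmap A h x) = fmap shift h (fmap A (inl_ a) x).
Proof. by rewrite /= -!fmap_comp shift_hom_inl. Qed.

Definition to_shift : nattrans A shift :=
  @NatTrans C A shift (fun c => fmap A (inl_ c)) to_shift_natural.

Lemma to_shift_retract (c : C) : exists k : hom (s c) c,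
  comp k (inl_ c) = idm c.
Proof. by have [k] := from_c0 c; exists (cop (idm c) k); rewrite cop_inl. Qed.

(** lim (shift A) = A c0.  Pull z at s c back along the codiagonal-like map
    k = [id, inr] from s (s c): restricted along s inl it is the identity, and
    restricted along s inr it factors through c0. *)
Lemma lim_shiftE (z : lim shift) : exists y : A c0, forall c,
  z c = fmap A (inr_ c) y.
Proof.
exists (fmap A (cop (idm c0) (idm c0)) (z c0)) => c.
(* The two restrictions of k compare the components of z at s c and at c0. *)
pose k : hom (s (s c)) (s c) := cop (idm (s c)) (inr_ c).
have zl := lim_valP z (inl_ c); have zr := lim_valP z (inr_ c).
have kl : comp k (shift_hom (inl_ c)) = idm (s c).
  apply: cop_eq; rewrite -compA ?shift_hom_inl ?shift_hom_inr ?comp1m ?cop_inr //.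
  by rewrite compA cop_inl comp1m.
have kr : comp k (shift_hom (inr_ c)) =
    comp (inr_ c) (cop (idm c0) (idm c0)).
  apply: cop_eq; rewrite -!compA ?shift_hom_inl ?shift_hom_inr ?cop_inl ?cop_inr
    ?compm1 //.
  by rewrite compA cop_inl comp1m.
by rewrite -fmap_comp -kr fmap_comp zr -zl /= -fmap_comp kl fmap_id.
Qed.

End Shift.

Definition shift_map (A B : abfunctor C) (t : nattrans A B) :
  nattrans (shift A) (shift B) :=
  @NatTrans C (shift A) (shift B) (fun c => t (s c))
    (fun a b h x => ntmapE t (shift_hom h) x).

Lemma to_shift_nat (A B : abfunctor C) (t : nattrans A B) c x :
  to_shift B c (t c x) = shift_map t c (to_shift A c x).
Proof. by rewrite /= ntmapE. Qed.

Section Retract.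
Variables (A I : abfunctor C) (e : nattrans A I) (u : nattrans (shift A) I).
Hypothesis Iinj : injective_object I.
Hypothesis uE : forall c x, u c (to_shift A c x) = e c x.
Hypothesis u0 : forall c y, shift_map e c y = 0 -> u c y = 0.

(** If u extends e along A -> shift A and vanishes on the kernel of shift e, a
    retraction of I -> shift I through which u factors exists: it has to be x on
    x in I and u y on the image of y in shift A, and both prescriptions agree
    because a pointwise (non-natural) retraction c + c0 -> c shows that an x in
    the image of shift A comes from A. *)
Lemma retract_step : exists rho : nattrans (shift I) I,
  (forall c x, rho c (to_shift I c x) = x) /\
  (forall c y, rho c (shift_map e c y) = u c y).
Proof.
have idB c : zmod_morphism (fun x : I c => x) by [].
pose idI : nattrans I I := nattrans_of idB (fun _ _ _ _ => erefl).
have [c [x y] /= xy|g gE] := @injective_object_ext C _ _ I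
    (copair (to_shift I) (shift_map e)) (copair idI u) Iinj.
  have [k kE] := to_shift_retract c.
  pose w := - fmap A k y.
  have xE : x = e c w.
    move: xy => /(congr1 (fmap I k)); rewrite raddf0 raddfD /= -fmap_comp kE fmap_id.
    by rewrite -ntmapE => /eqP; rewrite addr_eq0 => /eqP ->; rewrite raddfN.
  have /u0 : shift_map e c (to_shift A c w + y) = 0.
    by rewrite raddfD -to_shift_nat -xE.
  by rewrite raddfD uE -xE.
exists g; split=> c x.
  by have := gE c (x, 0); rewrite /= /additive_fun /= !raddf0 !addr0.
by have := gE c (0, x); rewrite /= /additive_fun /= !raddf0 !add0r.
Qed.

End Retract.

Section RetractVanishing.
Variables (A : abfunctor C) (rho : nattrans (shift A) A).
Hypothesis rhoK : forall c x, rho c (to_shift A c x) = x.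

(** The two properties of r are what the induction needs: the second one lets
    the composite of d and r be extended along shift d. *)
Lemma retract_resolution (I : injective_resolution A) n :
  exists r : nattrans (shift (ires_ob I n)) (ires_ob I n),
  (forall c x, r c (to_shift _ c x) = x) /\
  (forall c y, shift_map (ires_d I n) c y = 0 -> ires_d I n c (r c y) = 0).
Proof.
elim: n => [|n [r [rK r0]]].
  have [c x|c y|r [rK rE]] := @retract_step A (ires_ob I 0) (ires_aug I)
    (nt_comp (ires_aug I) rho) (@ires_inj _ _ I 0).
  - by rewrite /= rhoK.
  - rewrite /= -[X in _ = X -> _](raddf0 (ires_aug I (s c))).
    by move=> /ires_aug_mono ->; rewrite !raddf0.
  exists r; split=> // c y /ires_exact0 [x <-].
  by have := rE c x; rewrite /= => ->; apply: ires_d_aug.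
have [c x|c y|r' [r'K r'E]] := @retract_step _ _ (ires_d I n)
  (nt_comp (ires_d I n) r) (@ires_inj _ _ I n.+1).
- by rewrite /= rK.
- exact: r0.
exists r'; split=> // c y /ires_exact [x <-].
by have := r'E c x; rewrite /= => ->; apply: ires_dK.
Qed.

(** A cocycle z in lim I^(n+1), pushed to lim (shift I^(n+1)) = I^(n+1) c0, is the
    coboundary of some y; since the retractions commute with d, the retraction
    of y has coboundary the retraction of z, which is z because the retractions
    are left inverses of I -> shift I. *)
Lemma retract_limi (I : injective_resolution A) n (x : limi I n.+1) : x = 0.
Proof.
move: x; apply/limiS_eq0 => z /lim_map_eq0 zd.
have [r [rK r0]] := retract_resolution I n.
have [r' [r'K r'E]] : exists r' : nattrans (shift (ires_ob I n.+1)) (ires_ob I n.+1),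
    (forall c x, r' c (to_shift _ c x) = x) /\
    (forall c y, r' c (shift_map (ires_d I n) c y) = ires_d I n c (r c y)).
  apply: (@retract_step _ _ (ires_d I n) (nt_comp (ires_d I n) r)) => [|c x|c y].
  - exact: ires_inj.
  - by rewrite /= rK.
  - exact: r0.
have [y0 y0E] := lim_shiftE (lim_map (to_shift _) z).
have /ires_exact [y1 y1E] : ires_d I n.+1 c0 y0 = 0.
  have H : fmap _ (inr_ c0) (ires_d I n.+1 c0 y0) = 0.
    by rewrite -ntmapE -y0E /= ntmapE zd raddf0.
  have -> : ires_d I n.+1 c0 y0 = fmap _ (cop (idm c0) (idm c0))
      (fmap _ (inr_ c0) (ires_d I n.+1 c0 y0)).
    by rewrite -fmap_comp cop_inr fmap_id.
  by rewrite H raddf0.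
pose y c := r c (fmap (ires_ob I n) (inr_ c) y1 : shift (ires_ob I n) c).
have yC : compatible y.
  move=> a b h; rewrite /y -ntmapE; congr (r b _).
  by rewrite /= -fmap_comp shift_hom_inr.
exists (Lim yC); apply/lim_map_eq => c /=.
rewrite /y -r'E /= ntmapE y1E -y0E; exact: r'K.
Qed.

(** A compatible family x satisfies x (c + c0) = A inl (x c) = A inr (x c0). *)
Lemma retract_lim : (forall c x, rho c (fmap A (inr_ c) x) = 0) ->
  forall x : lim A, x = 0.
Proof.
move=> rho0 x; apply/lim_eq0 => c.
rewrite -[x c]rhoK /= lim_valP -(lim_valP x (inr_ c)); exact: rho0.
Qed.

Lemma retract_lim_trivial : (forall c x, rho c (fmap A (inr_ c) x) = 0) ->
  lim_trivial A.
Proof.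
by move=> rho0 I [|n]; [exact/lim0_limi0/retract_lim | exact: retract_limi].
Qed.

End RetractVanishing.

End CoproductWith.

(** * Dimension shifting *)

Section DimensionShift.
Variables (C : category) (A B D : abfunctor C).
Variables (i : nattrans A B) (p : nattrans B D).
Hypothesis i_inj : forall c, injective (i c).
Hypothesis ip_exact : forall c x, p c x = 0 <-> exists y, i c y = x.
Hypothesis p_surj : forall c y, exists x, p c x = y.
Variables (I : injective_resolution A) (L : injective_resolution D).

Lemma horseshoe_aug : exists psi : nattrans B (ires_ob I 0),
  forall c a, psi c (i c a) = ires_aug I c a.
Proof. exact: ires_inj. Qed.

Let psi := projT1 (cid horseshoe_aug).
Let psiE c a : psi c (i c a) = ires_aug I c a := projT2 (cid horseshoe_aug) c a.

(** An extension of f one degree further requires that d o f vanish on the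
    kernel of d. *)
Definition preserves_cocycles n (f : nattrans (ires_ob L n) (ires_ob I n.+1)) :=
  forall c y, ires_d L n c y = 0 -> ires_d I n.+1 c (f c y) = 0.

Lemma connecting0 : exists f : nattrans (ires_ob L 0) (ires_ob I 1),
  preserves_cocycles f /\
  forall c b, f c (ires_aug L c (p c b)) = ires_d I 0 c (psi c b).
Proof.
have [c x|f fE] := @injective_object_ext _ _ _ _ (nt_comp (ires_aug L) p)
    (nt_comp (ires_d I 0) psi) (@ires_inj _ _ I 1).
  rewrite /= -[X in _ = X -> _](raddf0 (ires_aug L c)) => /ires_aug_mono.
  by move=> /ip_exact [a <-]; rewrite psiE ires_d_aug.
exists f; split; last exact: fE.
move=> c y /ires_exact0 [d <-]; have [b <-] := p_surj d.
by have := fE c b; rewrite /= => ->; apply: ires_dK.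
Qed.

Lemma connectingS n (f : nattrans (ires_ob L n) (ires_ob I n.+1)) :
  preserves_cocycles f ->
  exists g : nattrans (ires_ob L n.+1) (ires_ob I n.+2),
  preserves_cocycles g /\
  forall c y, g c (ires_d L n c y) = ires_d I n.+1 c (f c y).
Proof.
move=> f0; have [c x|g gE] := @injective_object_ext _ _ _ _ (ires_d L n)
    (nt_comp (ires_d I n.+1) f) (@ires_inj _ _ I n.+2); first exact: f0.
exists g; split; last exact: gE.
move=> c y /ires_exact [x <-].
by have := gE c x; rewrite /= => ->; apply: ires_dK.
Qed.

(** A chain map from L to I shifted by one degree, lifting the map D -> I^1
    induced by d o psi; on limits it is, up to sign, the connecting homomorphism. *)
Fixpoint connecting_sig n : {f : nattrans (ires_ob L n) (ires_ob I n.+1) |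
    preserves_cocycles f} :=
  match n with
  | 0 => let: exist f fP := cid connecting0 in exist _ f fP.1
  | m.+1 => let: exist f fP := connecting_sig m in
            let: exist g gP := cid (connectingS fP) in exist _ g gP.1
  end.

Definition connecting n := projT1 (connecting_sig n).

Lemma connecting_aug c b :
  connecting 0 c (ires_aug L c (p c b)) = ires_d I 0 c (psi c b).
Proof. by rewrite /connecting /=; case: cid => f [? fE]. Qed.

Lemma connecting_d n c y :
  connecting n.+1 c (ires_d L n c y) = ires_d I n.+1 c (connecting n c y).
Proof.
rewrite /connecting /=; case: (connecting_sig n) => f fP /=.
by case: cid => g [? gE].
Qed.

Definition horseshoe_ob n := dsum (ires_ob I n) (ires_ob L n).

(** The sign makes d o d = 0, as the connecting map commutes with d. *)
Definition horseshoe_d n : nattrans (horseshoe_ob n) (horseshoe_ob n.+1) :=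
  pairing (copair (ires_d I n) (connecting n))
          (nt_opp (nt_comp (ires_d L n) (dsum_snd _ _))).

Lemma horseshoe_dE n c x y : horseshoe_d n c (x, y) =
  (ires_d I n c x + connecting n c y, - ires_d L n c y).
Proof. by []. Qed.

Definition horseshoe_in : nattrans B (horseshoe_ob 0) :=
  pairing psi (nt_opp (nt_comp (ires_aug L) p)).

Lemma horseshoe_inE c b : horseshoe_in c b = (psi c b, - ires_aug L c (p c b)).
Proof. by []. Qed.

Lemma horseshoe_in_inj c : injective (horseshoe_in c).
Proof.
move=> b b' /eqP; rewrite -subr_eq0 -raddfB => /eqP; rewrite horseshoe_inE => -[] E /eqP.
rewrite oppr_eq0 -(raddf0 (ires_aug L c)) => /eqP/ires_aug_mono/ip_exact [a aE].
apply/eqP; rewrite -subr_eq0 -aE; move: E; rewrite -aE psiE.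
by rewrite -(raddf0 (ires_aug I c)) => /ires_aug_mono ->; rewrite raddf0.
Qed.

Lemma horseshoe_exact0 c x :
  horseshoe_d 0 c x = 0 <-> exists b, horseshoe_in c b = x.
Proof.
case: x => x y; rewrite horseshoe_dE; split=> [[] xy /eqP|[b]]; last first.
  rewrite horseshoe_inE => -[<- <-].
  by rewrite !raddfN ires_d_aug /= connecting_aug subrr !oppr0.
rewrite oppr_eq0 => /eqP /ires_exact0 [d dE].
have [b bE] := p_surj (- d).
have /ires_exact0 [a aE] : ires_d I 0 c (x - psi c b) = 0.
  rewrite raddfB -connecting_aug bE raddfN dE raddfN opprK; exact: xy.
exists (i c a + b); rewrite horseshoe_inE raddfD psiE aE subrK raddfD bE.
by rewrite (iffRL (ip_exact (i c a))) ?add0r ?raddfN ?opprK ?dE //; exists a.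
Qed.

Lemma horseshoe_exact n c x :
  horseshoe_d n.+1 c x = 0 <-> exists y, horseshoe_d n c y = x.
Proof.
case: x => x y; rewrite horseshoe_dE; split=> [[] xy /eqP|[[x' y']]]; last first.
  rewrite horseshoe_dE => -[<- <-].
  by rewrite raddfD !raddfN !ires_dK /= connecting_d add0r subrr !oppr0.
rewrite oppr_eq0 => /eqP /ires_exact [d dE].
have /ires_exact [a aE] : ires_d I n.+1 c (x + connecting n c d) = 0.
  by rewrite raddfD -connecting_d dE.
by exists (a, - d); rewrite horseshoe_dE aE !raddfN addrK opprK dE.
Qed.

Definition horseshoe : injective_resolution B :=
  @InjectiveResolution C B horseshoe_ob horseshoe_d horseshoe_in
    (fun n => dsum_injective (@ires_inj _ _ I n) (@ires_inj _ _ L n))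
    horseshoe_in_inj horseshoe_exact0 horseshoe_exact.

Hypothesis Btriv : lim_trivial B.

Lemma lim_pair_compatible n (x : lim (ires_ob I n)) (y : lim (ires_ob L n)) :
  compatible (fun c => (x c, y c) : horseshoe_ob n c).
Proof. by move=> a b h; rewrite /= /additive_fun /dsum_fun /= !lim_valP. Qed.

Definition lim_pair n x y : lim (horseshoe_ob n) := Lim (@lim_pair_compatible n x y).

Definition lim_fst n (z : lim (horseshoe_ob n)) : lim (ires_ob I n) :=
  lim_map (dsum_fst _ _) z.

Definition lim_snd n (z : lim (horseshoe_ob n)) : lim (ires_ob L n) :=
  lim_map (dsum_snd _ _) z.

Lemma lim_horseshoe_cocycle0 (x : lim (ires_ob I 0)) (y : lim (ires_ob L 0)) :
  (forall c, ires_d I 0 c (x c) + connecting 0 c (y c) = 0) ->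
  (forall c, ires_d L 0 c (y c) = 0) -> x = 0 /\ y = 0.
Proof.
move=> xy yd; have /limi0_eq0 H := Btriv (I := horseshoe) (n := 0).
have /lim_eq0 z0 : lim_pair x y = 0.
  by apply: H; apply/lim_map_eq0 => c; rewrite horseshoe_dE xy yd oppr0.
by split; apply/lim_eq0 => c; have [] := z0 c.
Qed.

Lemma lim_horseshoe_cocycle n (x : lim (ires_ob I n.+1)) (y : lim (ires_ob L n.+1)) :
  (forall c, ires_d I n.+1 c (x c) + connecting n.+1 c (y c) = 0) ->
  (forall c, ires_d L n.+1 c (y c) = 0) ->
  exists (x' : lim (ires_ob I n)) (y' : lim (ires_ob L n)), forall c,
    x c = ires_d I n c (x' c) + connecting n c (y' c) /\
    y c = - ires_d L n c (y' c).
Proof.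
move=> xy yd; have /limiS_eq0 H := Btriv (I := horseshoe) (n := n.+1).
have [|z zE] := H (lim_pair x y).
  by apply/lim_map_eq0 => c; rewrite horseshoe_dE xy yd oppr0.
exists (lim_fst z), (lim_snd z) => c.
have := proj1 (lim_map_eq _ _ _) zE c.
by rewrite [z c]surjective_pairing horseshoe_dE => -[<- <-].
Qed.

(** The cocycle (x, 0) of the horseshoe resolution is a coboundary. *)
Lemma connecting_surj n (x : lim (ires_ob I n.+1)) :
  lim_map (ires_d I n.+1) x = 0 ->
  exists (x' : lim (ires_ob I n)) (y' : lim (ires_ob L n)),
    lim_map (ires_d L n) y' = 0 /\
    x = lim_map (ires_d I n) x' + lim_map (connecting n) y'.
Proof.
move=> /lim_map_eq0 xd.
have [c|c|x' [y' xy]] := @lim_horseshoe_cocycle n x 0.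
- by rewrite xd raddf0 addr0.
- by rewrite raddf0.
exists x', y'; split; last by apply: limP => c; rewrite (xy c).1.
by apply/lim_map_eq0 => c; apply: oppr_inj; rewrite -(xy c).2 oppr0.
Qed.

Lemma shift_vanishing0 (x : limi I 0) : x = 0.
Proof.
move: x; apply/limi0_eq0 => x /lim_map_eq0 xd.
have [] // := @lim_horseshoe_cocycle0 x 0 => c; last by rewrite raddf0.
by rewrite xd raddf0 addr0.
Qed.

Lemma shift_vanishing n :
  (forall x : limi L n, x = 0) -> forall x : limi I n.+1, x = 0.
Proof.
move=> Ln; apply/limiS_eq0 => x /connecting_surj [x' [y' [y'd ->]]].
case: n x x' y' y'd Ln => [|n] x x' y' y'd.
  by move=> /limi0_eq0 /(_ _ y'd) ->; exists x'; rewrite raddf0 addr0.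
move=> /limiS_eq0 /(_ _ y'd) [y'' <-].
exists (x' + lim_map (connecting n) y''); rewrite raddfD; congr (_ + _).
by apply: limP => c /=; rewrite connecting_d.
Qed.

(** lim^1 A = lim^0 D; the isomorphism is constructed from V to lim^1 A, where it
    has a formula, and then inverted. *)
Lemma shift_iso (V : zmodType) (e : {additive V -> lim D}) :
  bijective e -> ab_isomorphic (limi I 1) V.
Proof.
move=> e_bij.
pose t (v : V) := lim_map (connecting 0) (lim_map (ires_aug L) (e v)).
have td v : ker_subgrp (lim_map (ires_d I 1)) (t v).
  apply/lim_map_eq0 => c /=; rewrite (projT2 (connecting_sig 0)) //.
  exact: ires_d_aug.
have tB : zmod_morphism t by move=> v w; rewrite /t !raddfB.
pose T (v : V) : limi I 1 := scls (im_subgrp (lim_map (ires_d I 0))) (td v).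
have TB : zmod_morphism T.
  move=> v w; rewrite /T /scls -raddfB; congr subquot_class.
  by apply: val_inj; rewrite raddfB /= tB.
have T0 v : T v = 0 -> v = 0.
  rewrite -(raddf0 (subquot_class _)) => /subquot_class_eq [x] /=.
  rewrite subr0 => xE.
  have [c|c|_ y0] := @lim_horseshoe_cocycle0 (- x) (lim_map (ires_aug L) (e v)).
  - rewrite raddfN; apply/eqP; rewrite addrC subr_eq0 eq_sym; apply/eqP.
    exact: (proj1 (lim_map_eq _ _ _) xE c).
  - exact: ires_d_aug.
  apply: (bij_inj e_bij); rewrite raddf0; apply/lim_eq0 => c.
  apply: (@ires_aug_mono _ _ L); rewrite raddf0.
  exact: (proj1 (lim_eq0 _) y0 c).
have T_surj q : exists v, T v = q.
  have [x ->] := subquot_classP q.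
  have [x' [y' [/lim_map_eq0 y'd xE]]] := connecting_surj (subgrp_valP x).
  have [z zE] := @lim_lift _ _ _ (ires_aug L) y' (@ires_aug_mono _ _ L)
    (fun c => proj1 (@ires_exact0 _ _ L c _) (y'd c)).
  have [e' _ eK] := e_bij.
  exists (e' z); apply/subquot_class_eq; exists (- x') => /=.
  by rewrite xE /t eK zE opprD addrCA subrr addr0 raddfN.
have T_inj : injective T.
  by move=> v w /eqP; rewrite -subr_eq0 -TB => /eqP/T0/eqP; rewrite subr_eq0 => /eqP.
pose S q := projT1 (cid (T_surj q)).
have SK q : T (S q) = q := projT2 (cid (T_surj q)).
have SB : zmod_morphism S by move=> q r; apply: T_inj; rewrite TB !SK.
by exists (additive_of SB); exists T => [q|v]; [exact: SK | apply: T_inj; exact: SK].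
Qed.

End DimensionShift.

Section LimTrivialShift.
Variables (C : category) (A B D : abfunctor C).
Variables (i : nattrans A B) (p : nattrans B D).
Hypothesis i_inj : forall c, injective (i c).
Hypothesis ip_exact : forall c x, p c x = 0 <-> exists y, i c y = x.
Hypothesis p_surj : forall c y, exists x, p c x = y.

Lemma ses_lim_trivial : lim_trivial B -> lim_trivial D -> lim_trivial A.
Proof.
move=> Bt Dt I [|n] x.
  exact: (shift_vanishing0 i_inj ip_exact p_surj (std_resolution D) Bt).
exact: (shift_vanishing i_inj ip_exact p_surj Bt (Dt (std_resolution D) n)).
Qed.

End LimTrivialShift.

(** * Groups of words, free groups and free products *)

Section WordGroup.
Variables (X : Type) (model : forall H : groupType, (X -> H) -> Prop).

Definition word : Type := seq (bool * X).

Section Eval.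
Variables (H : groupType) (f : X -> H).

Definition letter_eval (l : bool * X) : H :=
  if l.1 then ((f l.2)^-1)%g else f l.2.

Fixpoint word_eval (w : word) : H :=
  if w is l :: w' then (letter_eval l * word_eval w')%g else 1%g.

Lemma word_eval_cat w w' : word_eval (w ++ w') = (word_eval w * word_eval w')%g.
Proof. by elim: w => [|l w IH] /=; rewrite ?mul1g // IH mulgA. Qed.

Definition word_inv (w : word) : word := rev [seq (~~ l.1, l.2) | l <- w].

Lemma word_eval_inv w : word_eval (word_inv w) = ((word_eval w)^-1)%g.
Proof.
elim: w => [|l w IH] /=; first by rewrite invg1.
rewrite /word_inv /= rev_cons -cats1 word_eval_cat [word_eval (rev _)]IH invgM /= mulg1.
by congr (_ * _)%g; rewrite /letter_eval /=; case: l.1; rewrite ?invgK.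
Qed.

End Eval.

(** The maps f range over groups of the larger universe of [groupType], while the
    group of words stays at the level of X, since a proposition may quantify
    over them.  Hence the group of words is again a [group], and it has its
    universal property with respect to large groups such as groups of matrices
    over a group ring. *)
Definition word_equiv (w w' : word) : Prop :=
  forall (H : groupType) (f : X -> H), model f -> word_eval f w = word_eval f w'.

Definition wsort : Type := {P : word -> Prop | exists w, P = word_equiv w}.

Definition wclass (w : word) : wsort := exist _ (word_equiv w) (ex_intro _ w erefl).

Definition wrepr (x : wsort) : word := projT1 (cid (proj2_sig x)).

Lemma wreprK x : wclass (wrepr x) = x.
Proof.
case: x => P PP; rewrite /wrepr /=; case: cid => w /= E.
by subst P; congr exist; exact: Prop_irrelevance.
Qed.

Lemma wclass_eq w w' : wclass w = wclass w' <-> word_equiv w w'.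
Proof.
split=> [E|ww'].
  have -> : word_equiv w w' = sval (wclass w) w' by [].
  by rewrite E.
have E : word_equiv w = word_equiv w'.
  apply/funext => v; apply/propext; split=> wv H f mf; rewrite -wv //.
    by rewrite ww'.
  by rewrite ww'.
rewrite /wclass; move: (ex_intro _ w _) (ex_intro _ w' _); rewrite E => p q.
by congr exist; exact: Prop_irrelevance.
Qed.

Lemma wrepr_class w : word_equiv (wrepr (wclass w)) w.
Proof. by apply/wclass_eq; rewrite wreprK. Qed.

Definition wop x y := wclass (wrepr x ++ wrepr y).
Definition wunit := wclass [::].
Definition winv x := wclass (word_inv (wrepr x)).

Lemma wopE w w' : wop (wclass w) (wclass w') = wclass (w ++ w').
Proof.
by apply/wclass_eq => H f mf; rewrite !word_eval_cat !(wrepr_class _ mf).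
Qed.

Lemma winvE w : winv (wclass w) = wclass (word_inv w).
Proof.
by apply/wclass_eq => H f mf; rewrite !word_eval_inv (wrepr_class _ mf).
Qed.

Lemma wopA : associative wop.
Proof.
move=> x y z; rewrite -(wreprK x) -(wreprK y) -(wreprK z) !wopE.
by rewrite catA.
Qed.

Lemma wop1 : left_id wunit wop.
Proof. by move=> x; rewrite -(wreprK x) wopE. Qed.

Lemma wop1r : right_id wunit wop.
Proof. by move=> x; rewrite -(wreprK x) wopE cats0. Qed.

Lemma wopV : left_inverse wunit winv wop.
Proof.
move=> x; rewrite -(wreprK x) winvE wopE; apply/wclass_eq => H f mf.
by rewrite word_eval_cat word_eval_inv mulVg.
Qed.

Lemma wopVr : right_inverse wunit winv wop.
Proof.
move=> x; rewrite -(wreprK x) winvE wopE; apply/wclass_eq => H f mf.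
by rewrite word_eval_cat word_eval_inv mulgV.
Qed.

Definition word_group : group := Group wopA wop1 wop1r wopV wopVr.

Definition wgen (x : X) : word_group := wclass [:: (false, x)].

Lemma wmulE (x y : word_group) : (x * y)%g = wop x y. Proof. by []. Qed.

Section Lift.
Variables (H : groupType) (f : X -> H).
Hypothesis mf : model f.

Definition wlift (x : word_group) : H := word_eval f (wrepr x).

Lemma wliftM : {morph wlift : x y / (x * y)%g}.
Proof.
by move=> x y; rewrite /wlift wmulE (wrepr_class _ mf) word_eval_cat.
Qed.

Lemma wlift_gen x : wlift (wgen x) = f x.
Proof. by rewrite /wlift (wrepr_class _ mf) /= mulg1. Qed.

End Lift.

Lemma wgen_ind (P : word_group -> Prop) :
  P 1%g -> (forall x y, P x -> P y -> P (x * y)%g) ->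
  (forall x, P x -> P (x^-1)%g) -> (forall x, P (wgen x)) -> forall x, P x.
Proof.
move=> P1 PM PV Pg x; rewrite -(wreprK x); elim: (wrepr x) => [|[b l] w IH] //.
rewrite -[wclass _](wopE [:: (b, l)] w).
apply: (PM (wclass [:: (b, l)]) (wclass w)) => //; case: b; last exact: Pg.
have -> : wclass [:: (true, l)] = ((wgen l)^-1)%g :> word_group.
  by rewrite [RHS]winvE.
exact/PV/Pg.
Qed.

Lemma whom_eq (H : group) (h k : ghom word_group H) :
  (forall x, h (wgen x) = k (wgen x)) -> h =1 k.
Proof.
move=> hk; apply: wgen_ind => [|x y hx hy|x hx|//]; first by rewrite !ghom1.
  by rewrite !ghomM hx hy.
apply: (mulgI (h x)); rewrite -ghomM [in RHS]hx -ghomM mulgV.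
by rewrite !ghom1.
Qed.

End WordGroup.

Definition free_on (X : Type) : group := word_group (fun (H : groupType) (f : X -> H) => True).

Lemma free_on_free X : is_free (free_on X).
Proof.
exists X, (@wgen X _) => H f; exists (GHom (wliftM (f := f) I)); split=> [x|h hE].
  exact: wlift_gen.
by apply: whom_eq => x; rewrite hE; symmetry; exact: wlift_gen.
Qed.

(** The universal property of F only concerns small groups.  For a large group
    H, go through the group of words free on the elements of F, which is small
    and maps to H by evaluation of f.  The second part is that a basis generates F: the subgroup P
    is small, so F maps to it. *)
Lemma free_group_ext (F : group) : is_free F ->
  exists (X : Type) (i : X -> F),
    (forall (H : groupType) (f : F -> H), exists h : F -> H,
       {morph h : x y / (x * y)%g} /\ forall x, h (i x) = f (i x)) /\
    (forall P : F -> Prop, P 1%g -> (forall x y, P x -> P y -> P (x * y)%g) ->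
       (forall x, P x -> P (x^-1)%g) -> (forall x, P (i x)) -> forall x, P x).
Proof.
move=> [X [i iP]]; exists X, i; split=> [H f|P P1 PM PV Pi x].
  have [h [hE _]] := iP (free_on F) (fun x => wgen _ (i x)).
  exists (fun x => wlift f (h x)); split=> [x y|x]; first by rewrite ghomM wliftM.
  by rewrite hE wlift_gen.
pose S := {x : F | P x}.
have SP (x : S) : P (sval x) := proj2_sig x.
pose op (x y : S) : S := exist P _ (PM _ _ (SP x) (SP y)).
pose inv (x : S) : S := exist P _ (PV _ (SP x)).
pose un : S := exist P _ P1.
have sI (u w : S) : sval u = sval w -> u = w.
  case: u w => a Pa [b Pb] /= E; subst b.
  by congr exist; exact: Prop_irrelevance.
have opA : associative op by move=> a b c; apply: sI; rewrite /= mulgA.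
have op1 : left_id un op by move=> a; apply: sI; rewrite /= mul1g.
have op1r : right_id un op by move=> a; apply: sI; rewrite /= mulg1.
have opV : left_inverse un inv op by move=> a; apply: sI; rewrite /= mulVg.
have opVr : right_inverse un inv op by move=> a; apply: sI; rewrite /= mulgV.
pose K := Group opA op1 op1r opV opVr.
have [h [hE _]] := iP K (fun x => exist P _ (Pi x)).
pose v : ghom K F := @GHom K F (fun x : K => sval x) (fun _ _ => erefl).
have [j [_ jU]] := iP F i.
have -> : x = v (h x).
  rewrite -[LHS]/(ghom_id F x) (jU (ghom_id F)) // -[RHS]/(ghom_comp v h x).
  by rewrite (jU (ghom_comp v h)) // => y /=; rewrite hE.
exact: SP.
Qed.

Section FreeProduct.
Variables F E : group.

Definition free_product_model (H : groupType) (f : F + E -> H) : Prop :=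
  {morph (fun x => f (inl x)) : x y / (x * y)%g} /\
  {morph (fun x => f (inr x)) : x y / (x * y)%g}.

Definition free_product : group := word_group free_product_model.

Lemma fp_inlM : {morph (fun x => wgen free_product_model (inl x)) : x y / (x * y)%g}.
Proof.
move=> x y; rewrite wmulE wopE; apply/wclass_eq => H f mf /=.
by rewrite !mulg1 /letter_eval /= mf.1.
Qed.

Lemma fp_inrM : {morph (fun x => wgen free_product_model (inr x)) : x y / (x * y)%g}.
Proof.
move=> x y; rewrite wmulE wopE; apply/wclass_eq => H f mf /=.
by rewrite !mulg1 /letter_eval /= mf.2.
Qed.

Definition fp_inl : ghom F free_product := GHom fp_inlM.
Definition fp_inr : ghom E free_product := GHom fp_inrM.

Section Copair.
Variables (H : group) (h : ghom F H) (k : ghom E H).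

Definition fp_case (z : F + E) : H := match z with inl x => h x | inr y => k y end.

Lemma fp_caseP : free_product_model fp_case.
Proof. by split=> x y /=; rewrite ghomM. Qed.

Definition fp_copair : ghom free_product H := GHom (wliftM fp_caseP).

Lemma fp_copair_inl x : fp_copair (fp_inl x) = h x.
Proof. exact: (wlift_gen fp_caseP). Qed.

Lemma fp_copair_inr y : fp_copair (fp_inr y) = k y.
Proof. exact: (wlift_gen fp_caseP). Qed.

End Copair.

Lemma fp_hom_eq (H : group) (h k : ghom free_product H) :
  (forall x, h (fp_inl x) = k (fp_inl x)) ->
  (forall y, h (fp_inr y) = k (fp_inr y)) -> h =1 k.
Proof. by move=> hl hr; apply: whom_eq => -[x|y]; [exact: hl | exact: hr]. Qed.

Lemma free_product_free : is_free F -> is_free E -> is_free free_product.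
Proof.
move=> [X [i iP]] [Y [j jP]].
exists (X + Y)%type, (fun z => match z with
  inl x => fp_inl (i x) | inr y => fp_inr (j y) end) => H f.
have [h [hE hU]] := iP H (fun x => f (inl x)).
have [k [kE kU]] := jP H (fun y => f (inr y)).
exists (fp_copair h k); split=> [[x|y]|g gE].
- by rewrite fp_copair_inl hE.
- by rewrite fp_copair_inr kE.
apply: fp_hom_eq => [x|y].
  rewrite fp_copair_inl -[LHS]/(ghom_comp g fp_inl x).
  by apply: hU => z; rewrite /= (gE (inl z)).
rewrite fp_copair_inr -[LHS]/(ghom_comp g fp_inr y).
by apply: kU => z; rewrite /= (gE (inr z)).
Qed.

End FreeProduct.

(** * Coproducts of presentations *)

Section Presentations.
Variable G : group.
Implicit Types c d : presentation G.

Lemma presentation_exists : inhabited (presentation G).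
Proof.
pose t (g : G) := g; have tP : (fun (H : groupType) (f : G -> H) => True) _ t by [].
exists; apply: (@Presentation G (free_on G) (free_on_free G) (GHom (wliftM tP))).
by move=> g; exists (wgen _ g); exact: (wlift_gen tP).
Qed.

Lemma pres_hom_exists c d : inhabited (pres_hom c d).
Proof.
have [X [i iP]] := pgrp_free c.
pose f x := projT1 (cid (pmap_epi d (pmap c (i x)))).
have fE x : pmap d (f x) = pmap c (i x) := projT2 (cid (pmap_epi d _)).
have [h [hE _]] := iP _ f; exists; apply: (@PresHom G c d h) => x.
have [k [_ kU]] := iP _ (fun x => pmap c (i x)).
by rewrite (kU (pmap c)) // -[LHS]/(ghom_comp _ _ _) kU // => y /=; rewrite hE.
Qed.

Section Coproduct.
Variables c d : presentation G.

Lemma pres_sum_epi g : exists x, fp_copair (pmap c) (pmap d) x = g.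
Proof.
by have [x <-] := pmap_epi c g; exists (fp_inl _ _ x); rewrite fp_copair_inl.
Qed.

Definition pres_sum : presentation G :=
  Presentation (free_product_free (pgrp_free c) (pgrp_free d)) pres_sum_epi.

Definition pres_inl : pres_hom c pres_sum :=
  @PresHom G c pres_sum (fp_inl _ _) (fp_copair_inl (pmap c) (pmap d)).

Definition pres_inr : pres_hom d pres_sum :=
  @PresHom G d pres_sum (fp_inr _ _) (fp_copair_inr (pmap c) (pmap d)).

Lemma pres_copair_over b (h : pres_hom c b) (k : pres_hom d b) x :
  pmap b (fp_copair h k x) = pmap pres_sum x.
Proof.
apply: (@fp_hom_eq _ _ _ (ghom_comp (pmap b) (fp_copair h k)) (pmap pres_sum)) => y.
  rewrite [RHS]fp_copair_inl -(phom_over h) /=; congr (pmap b _).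
  exact: fp_copair_inl.
rewrite [RHS]fp_copair_inr -(phom_over k) /=; congr (pmap b _).
exact: fp_copair_inr.
Qed.

Definition pres_copair b (h : pres_hom c b) (k : pres_hom d b) :
  pres_hom pres_sum b :=
  @PresHom G pres_sum b (fp_copair h k) (pres_copair_over h k).

End Coproduct.

Lemma pres_copair_inl c d b (h : pres_hom c b) (k : pres_hom d b) :
  pres_comp (pres_copair h k) (pres_inl c d) = h.
Proof. by apply: pres_homP => x; exact: fp_copair_inl. Qed.

Lemma pres_copair_inr c d b (h : pres_hom c b) (k : pres_hom d b) :
  pres_comp (pres_copair h k) (pres_inr c d) = k.
Proof. by apply: pres_homP => x; exact: fp_copair_inr. Qed.

Lemma pres_sum_eq c d b (f g : pres_hom (pres_sum c d) b) :
  pres_comp f (pres_inl c d) = pres_comp g (pres_inl c d) ->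
  pres_comp f (pres_inr c d) = pres_comp g (pres_inr c d) -> f = g.
Proof.
move=> fl fr; apply/pres_homP/fp_hom_eq => x.
  exact: (congr1 (fun h : pres_hom c b => h x) fl).
exact: (congr1 (fun h : pres_hom d b => h x) fr).
Qed.

End Presentations.

(** * Products of ideals *)

Section GroupRingGeneration.
Variable F : group.

Lemma gr_subgrp_full (A : subgrp (group_ring F)) :
  (forall k, A (gr_of k)) -> forall x, A x.
Proof.
move=> Ak x; rewrite [x]monalgE; apply/smembP; apply: rpred_sum => k _.
by rewrite malgUz; apply: rpredMz; apply/smembP/Ak.
Qed.

Lemma aug_gr_of (k : F) : aug_ideal F (gr_of k - 1).
Proof. by rewrite /= raddfB /= !augmentationU subrr. Qed.

End GroupRingGeneration.

Section IdealProducts.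
Variable R : nzRingType.
Implicit Types I J K : ideal R.

Lemma ideal_prodA I J K x :
  ideal_prod I (ideal_prod J K) x <-> ideal_prod (ideal_prod I J) K x.
Proof.
split=> H.
  apply: (ideal_prod_ind _ H) => u w Iu JKw.
  pose A := preim_subgrp (GRing.mull_fun u idfun : {additive R -> R})
    (ideal_prod (ideal_prod I J) K).
  apply: (@ideal_prod_ind _ _ _ A _ _ JKw) => v t Jv Kt; rewrite /= mulrA.
  by do 2 apply: ideal_prodM => //.
apply: (ideal_prod_ind _ H) => u w IJu Kw.
pose A := preim_subgrp (GRing.mulr_fun w idfun : {additive R -> R})
  (ideal_prod I (ideal_prod J K)).
apply: (@ideal_prod_ind _ _ _ A _ _ IJu) => v t Iv Jt; rewrite /= -mulrA.
by do 2 apply: ideal_prodM => //.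
Qed.

Lemma ideal_prod3_ind I J K (A : subgrp R) :
  (forall x y z, I x -> J y -> K z -> A (x * y * z)) ->
  forall x, ideal_prod (ideal_prod I J) K x -> A x.
Proof.
move=> AIJK x H; apply: (ideal_prod_ind _ H) => u w IJu Kw.
pose B := preim_subgrp (GRing.mulr_fun w idfun : {additive R -> R}) A.
by apply: (@ideal_prod_ind _ _ _ B _ _ IJu) => v t Iv Jt; apply: AIJK.
Qed.

Lemma ideal_prodS I J I' J' x : (forall x, I x -> I' x) -> (forall x, J x -> J' x) ->
  ideal_prod I J x -> ideal_prod I' J' x.
Proof.
move=> II JJ H; apply: (ideal_prod_ind _ H) => u v Iu Jv.
by apply: ideal_prodM; [exact: II | exact: JJ].
Qed.

End IdealProducts.

(** * Unipotent matrices and the triple product map of a free group *)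

Section StrictlyUpper.
Variable R : nzRingType.
Local Notation M := 'M[R]_4.

(** A belongs to band k if it vanishes below the k-th superdiagonal. *)
Definition band k (A : M) := forall i j : 'I_4, (j < i + k)%N -> A i j = 0.

Lemma bandB k A B : band k A -> band k B -> band k (A - B).
Proof. by move=> A0 B0 i j ij; rewrite !mxE A0 ?B0 // subr0. Qed.

Lemma bandD k A B : band k A -> band k B -> band k (A + B).
Proof. by move=> A0 B0 i j ij; rewrite !mxE A0 ?B0 // addr0. Qed.

Lemma bandN k A : band k A -> band k (- A).
Proof. by move=> A0 i j ij; rewrite !mxE A0 // oppr0. Qed.

Lemma band0 k : band k 0.
Proof. by move=> i j ij; rewrite mxE. Qed.

Lemma bandM k l A B : band k A -> band l B -> band (k + l) (A * B).
Proof.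
move=> A0 B0 i j ij; rewrite !mxE big1 // => m _.
case: (ltnP m (i + k)) => [mi|im]; first by rewrite A0 ?mul0r.
by rewrite B0 ?mulr0 // (leq_trans ij) // addnA leq_add2r.
Qed.

Lemma bandW k l A : (l <= k)%N -> band k A -> band l A.
Proof. by move=> lk A0 i j ij; apply: A0; rewrite (leq_trans ij) // leq_add2l. Qed.

Lemma band4 A : band 4 A -> A = 0.
Proof.
move=> A0; apply/matrixP => i j; rewrite A0 ?mxE //.
by rewrite (leq_trans (ltn_ord j)) // leq_addl.
Qed.

(** The strictly upper triangular matrix u stands for the unipotent matrix
    1 + u, so that the group law is u + v + uv. *)
Definition unipotent : Type := {A : M | `[< band 1 A >]}.

HB.instance Definition _ := gen_eqMixin unipotent.
HB.instance Definition _ := gen_choiceMixin unipotent.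

Implicit Types u v w : unipotent.

Lemma unipotentP u : band 1 (val u). Proof. exact/asboolP/(valP u). Qed.

Definition unipotent_mk A (A0 : band 1 A) : unipotent := exist _ A (asboolT A0).

Lemma circle_band u v : band 1 (val u + val v + val u * val v).
Proof.
have [u0 v0] := (unipotentP u, unipotentP v).
by do ?apply: bandD => //; apply: (@bandW 2) => //; apply: (@bandM 1 1).
Qed.

Lemma circle_inv_band u :
  band 1 (- val u + val u * val u - val u * val u * val u).
Proof.
have u0 := unipotentP u.
apply: bandB; [apply: bandD; first exact: bandN|].
  by apply: (@bandW 2) => //; apply: (@bandM 1 1).
by apply: (@bandW 3) => //; apply: (@bandM 2 1) => //; apply: (@bandM 1 1).
Qed.

Definition unipotent_mul u v := unipotent_mk (@circle_band u v).
Definition unipotent_inv u := unipotent_mk (@circle_inv_band u).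
Definition unipotent_one := unipotent_mk (@band0 1).

Lemma unipotent_mulA : associative unipotent_mul.
Proof.
move=> u v w; apply: val_inj => /=.
rewrite !mulrDr !mulrDl !mulrA !addrA.
by rewrite [LHS](ACl (1*2*5*3*6*4*7)%AC).
Qed.

Lemma unipotent_mul1 : left_id unipotent_one unipotent_mul.
Proof. by move=> u; apply: val_inj; rewrite /= mul0r add0r addr0. Qed.

Lemma unipotent_mulr1 : right_id unipotent_one unipotent_mul.
Proof. by move=> u; apply: val_inj; rewrite /= mulr0 !addr0. Qed.

Lemma unipotent_pow4 u : val u * val u * val u * val u = 0.
Proof.
have u0 := unipotentP u; apply: band4.
exact: (bandM (bandM (bandM u0 u0) u0) u0).
Qed.

Lemma unipotent_mulV : left_inverse unipotent_one unipotent_inv unipotent_mul.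
Proof.
move=> u; apply: val_inj; rewrite /= !mulrDl !mulNr unipotent_pow4 oppr0 addr0.
by rewrite !addrA [LHS](ACl ((1*4)*(2*5)*(3*6))%AC) /= !addNr subrr !addr0.
Qed.

Lemma unipotent_mulVr : right_inverse unipotent_one unipotent_inv unipotent_mul.
Proof.
move=> u; apply: val_inj; rewrite /= !mulrDr !mulrN !mulrA unipotent_pow4 oppr0 addr0.
by rewrite !addrA [LHS](ACl ((1*2)*(3*5)*(4*6))%AC) /= !subrr addNr !addr0.
Qed.

HB.instance Definition _ := isGroup.Build unipotent
  unipotent_mulA unipotent_mul1 unipotent_mulr1 unipotent_mulV unipotent_mulVr.

End StrictlyUpper.

Lemma mul3_telescope (R : nzRingType) (p q r p' q' r' : R) :
  p * q * r - p' * q' * r' =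
  (p - p') * q * r + p' * (q - q') * r + p' * q' * (r - r').
Proof. by rewrite !mulrBr !mulrBl !addrA !subrK. Qed.

Section TripleProduct.
Variables (P F : group) (a : nat -> ghom P F).
Hypothesis Pfree : is_free P.

Local Notation R := (group_ring F).
Local Notation f := (aug_ideal F).
Local Notation ff := (ideal_prod f f).
Local Notation ffff := (ideal_prod (ideal_prod (ideal_prod f f) f) f).

(** The image of a basis element g, minus the identity matrix. *)
Definition superdiag (g : P) : 'M[R]_4 :=
  \matrix_(i, j) (if j == i.+1 :> nat then gr_of (a i g) - 1 else 0).

Lemma superdiag_band g : band 1 (superdiag g).
Proof. by move=> i j; rewrite addn1 => ij; rewrite mxE ltn_eqF. Qed.

(** The superdiagonal entries of h are homomorphisms to the additive group Z[F],
    and modulo ff so is g |-> a_i(g) - 1; both agree on the basis. *)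
Lemma unipotent_hom_exists : exists h : P -> unipotent R,
  {morph h : x y / (x * y)%g} /\
  forall g (i j : 'I_4), j = i.+1 :> nat -> ff (val (h g) i j - (gr_of (a i g) - 1)).
Proof.
have [X [b [ext ind]]] := free_group_ext Pfree.
have [h [hM hE]] := ext _ (fun g => unipotent_mk (@superdiag_band g)).
have h_mul x y : val (h (x * y)%g) = val (h x) + val (h y) + val (h x) * val (h y).
  by rewrite hM.
have h_super x y (i j : 'I_4) : j = i.+1 :> nat ->
    val (h (x * y)%g) i j = val (h x) i j + val (h y) i j.
  move=> ij; rewrite h_mul !mxE (_ : \sum_k _ = 0) ?addr0 //.
  have := bandM (unipotentP (h x)) (unipotentP (h y)) (i := i) (j := j).
  by rewrite mxE ij addn2 => ->.
have gr_super x y i : gr_of (a i (x * y)%g) - 1 =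
    (gr_of (a i x) - 1) + (gr_of (a i y) - 1) +
    (gr_of (a i x) - 1) * (gr_of (a i y) - 1).
  rewrite ghomM gr_ofM mulrBl mul1r mulrBr mulr1.
  rewrite !addrA opprB !addrA [RHS](ACl ((5*2)*(1*6)*(3*8)*(4*7))%AC) /=.
  by rewrite !subrr addNr !addr0.
have h1 : val (h 1%g) = 0.
  have /(congr1 (fun x => (h 1%g)^-1 * x)%g) := hM 1%g 1%g.
  by rewrite mulg1 mulKg mulVg => <-.
have gr1 i : gr_of (a i 1%g) - 1 = 0 by rewrite ghom1; exact: subrr.
exists h; split=> //; apply: ind => [|x y IHx IHy|x IHx|x] i j ij.
- by rewrite h1 gr1 mxE subr0; exact: smem0.
- rewrite h_super // gr_super [_ + _ + _ * _]addrC opprD addrA [_ - _ * _]addrC -addrA.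
  apply: smemD.
    by apply/smemN/ideal_prodM; exact: aug_gr_of.
  by rewrite opprD addrACA; apply: smemD; [exact: IHx | exact: IHy].
- have hV : val (h x^-1)%g i j = - val (h x) i j.
    apply/eqP; rewrite -addr_eq0 addrC -h_super //.
    by rewrite mulgV h1 mxE.
  have grV : gr_of (a i x^-1%g) - 1 = - (gr_of (a i x) - 1) -
      (gr_of (a i x) - 1) * (gr_of (a i x^-1%g) - 1).
    apply/eqP; rewrite -opprD -addr_eq0 addrC addrAC -gr_super.
    by rewrite mulgV gr1.
  rewrite hV grV opprB opprK addrCA addrC; apply: smemD.
    by rewrite addrC -opprB; apply: smemN; exact: IHx.
  by apply: ideal_prodM; exact: aug_gr_of.
by rewrite hE mxE ij eqxx subrr; exact: smem0.
Qed.

(** Extend the homomorphism to unipotent matrices to a ring homomorphism psi on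
    Z[P]; beta is its upper right corner.  On the augmentation ideal psi is
    strictly upper triangular with superdiagonal a_0, a_1, a_2 modulo ff, so the
    corner of a product of three factors is the product of the superdiagonal
    entries and the product of four factors vanishes. *)
Lemma triple_product_map : exists beta : {additive group_ring P -> R},
  (forall x, ideal_prod (ideal_prod (ideal_prod (aug_ideal P) (aug_ideal P))
     (aug_ideal P)) (aug_ideal P) x -> beta x = 0) /\
  (forall x y z, aug_ideal P x -> aug_ideal P y -> aug_ideal P z ->
     ffff (beta (x * y * z) - gr_map (a 0) x * gr_map (a 1) y * gr_map (a 2) z)).
Proof.
have [h [hM hE]] := unipotent_hom_exists.
pose psi : group_ring P -> 'M[R]_4 := linext (fun g => 1 + val (h g)).
have psiU g : psi (gr_of g) = 1 + val (h g) by rewrite /psi linextU.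
have psiB : zmod_morphism psi by exact: raddfB.
have h_mul x y : val (h (x * y)%g) = val (h x) + val (h y) + val (h x) * val (h y).
  by rewrite hM.
have psiM x y : psi (x * y) = psi x * psi y.
  move: x; apply: gr_ext => [x x'|x x'|k]; rewrite ?mulrBl ?psiB ?mulrBl //.
  move: y; apply: gr_ext => [y y'|y y'|l]; rewrite ?mulrBr ?psiB ?mulrBr //.
  rewrite -gr_ofM !psiU h_mul mulrDl mul1r mulrDr mulr1 !addrA.
  by rewrite [RHS](ACl (1*3*2*4)%AC).
have coefB i j : zmod_morphism (fun x => psi x i j).
  by move=> x y; rewrite psiB !mxE.
pose psi_ij i j : {additive group_ring P -> R} := additive_of (coefB i j).
have psi_diag x (i j : 'I_4) : (j < i + 1)%N -> psi x i j = (augmentation x)%:~R *+ (i == j).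
  move=> ij; move: x; apply: gr_ext => [x y|x y|k]; first exact: coefB.
    by rewrite raddfB rmorphB /= mulrnBl.
  by rewrite psiU !mxE (unipotentP (h k)) // addr0 augmentationU.
have psi_band x : aug_ideal P x -> band 1 (psi x).
  by move=> x0 i j ij; rewrite psi_diag // x0 mul0rn.
have psi_super x (i j : 'I_4) : j = i.+1 :> nat -> aug_ideal P x ->
    ff (psi x i j - gr_map (a i) x).
  move=> ij x0.
  have dB : zmod_morphism (fun x => psi x i j -
      (gr_map (a i) x - (augmentation x)%:~R)).
    have B2 (p q r s : R) : (p - q) - (r - s) = (p - r) - (q - s).
      by rewrite opprD addrACA -opprD.
    by move=> u v; rewrite coefB gr_mapB augmentationB mulrzBr [gr_map _ u - _ - _]B2; apply: B2.
  have := @gr_subgrp_full P (preim_subgrp (additive_of dB) ff).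
  rewrite /= /additive_fun => H.
  rewrite -[gr_map _ x]subr0 -[0](rmorph0 (intr : int -> R)) -x0.
  apply: H => k.
  rewrite augmentationU psiU gr_mapU mxE mxE.
  rewrite (_ : (i == j) = false) ?add0r; first exact: hE.
  by apply/eqP => ji; move: ij; rewrite ji => /eqP; rewrite ltn_eqF.
pose o (n : nat) : 'I_4 := inord n.
have oE n : (n < 4)%N -> o n = n :> nat by move=> n4; rewrite /o inordK.
exists (psi_ij (o 0%N) (o 3)); split=> [x Hx|x y z x0 y0 z0].
  pose A := preim_subgrp (psi_ij (o 0%N) (o 3)) (zero_subgrp R).
  apply: (@ideal_prod_ind _ _ _ A _ _ Hx) => {x Hx} u w.
  move=> Hu Hw; pose B := preim_subgrp (GRing.mulr_fun w idfun : {additive _ -> _}) A.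
  apply: (@ideal_prod3_ind _ _ _ _ B _ _ Hu) => x y z x0 y0 z0.
  rewrite /B /A /= /additive_fun !psiM.
  apply: (bandM (bandM (bandM (psi_band _ x0) (psi_band _ y0)) (psi_band _ z0)) (psi_band _ Hw)).
  by rewrite !oE.
(* By the band conditions only the path 0 -> 1 -> 2 -> 3 contributes to the
   corner of the product. *)
have -> : psi_ij (o 0%N) (o 3) (x * y * z) =
    psi x (o 0%N) (o 1%N) * psi y (o 1%N) (o 2) * psi z (o 2) (o 3).
  rewrite /= /additive_fun !psiM.
  rewrite mxE (bigD1 (o 2)) //= big1 ?addr0 => [|m m2].
    congr (_ * _); rewrite mxE (bigD1 (o 1%N)) //= big1 ?addr0 // => m m1.
    have [m0|m0] := leqP m 0.
      by rewrite (psi_band _ x0) ?mul0r // oE.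
    rewrite (psi_band _ y0) ?mulr0 // oE // addn1 ltnS.
    by rewrite ltn_neqAle m0 andbT eq_sym; apply: contraNneq m1 => m1; apply/eqP/val_inj; rewrite /= oE.
  have [m1|m1] := leqP m 1.
    rewrite (bandM (psi_band _ x0) (psi_band _ y0)) ?mul0r //.
    by rewrite oE.
  rewrite (psi_band _ z0) ?mulr0 // oE // addn1 ltnS.
  by rewrite ltn_neqAle m1 andbT eq_sym; apply: contraNneq m2 => m2; apply/eqP/val_inj; rewrite /= oE.
have Dx : ff (psi x (o 0%N) (o 1%N) - gr_map (a 0) x).
  by have := @psi_super x (o 0%N) (o 1%N); rewrite (oE 0%N isT) (oE 1%N isT) => /(_ erefl x0).
have Dy : ff (psi y (o 1%N) (o 2) - gr_map (a 1) y).
  by have := @psi_super y (o 1%N) (o 2); rewrite (oE 1%N isT) (oE 2 isT) => /(_ erefl y0).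
have Dz : ff (psi z (o 2) (o 3) - gr_map (a 2) z).
  by have := @psi_super z (o 2) (o 3); rewrite (oE 2 isT) (oE 3 isT) => /(_ erefl z0).
have fx : f (gr_map (a 0) x) by rewrite /= augmentation_map.
have fy : f (gr_map (a 1) y) by rewrite /= augmentation_map.
have fz : f (gr_map (a 2) z) by rewrite /= augmentation_map.
move: (psi x _ _) (psi y _ _) (psi z _ _) Dx Dy Dz => p q r.
move: (gr_map _ x) (gr_map _ y) (gr_map _ z) fx fy fz => p' q' r' fp' fq' fr' Dp Dq Dr.
have fff u : ff u -> f u.
  move=> H; apply: (@ideal_prod_ind _ _ _ (f : subgrp _) _ _ H) => s t _.
  exact: idealMl.
have fq : f q by rewrite -[q](subrK q'); apply: smemD => //; apply: fff.
have fr : f r by rewrite -[r](subrK r'); apply: smemD => //; apply: fff.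
rewrite mul3_telescope.
apply: smemD; first apply: smemD.
- by do 2 apply: ideal_prodM => //.
- by apply: ideal_prodM => //; apply/ideal_prodA/ideal_prodM.
- by apply/ideal_prodA/ideal_prodM => //; apply: ideal_prodM.
Qed.

End TripleProduct.

(** * The functors fff, W and their quotients *)

Section PresRetract.
Variables (G : group) (c0 : Pres G) (A : abfunctor (Pres G)).

Definition pres_shift_hom (a b : Pres G) (h : hom a b) :
    hom (pres_sum a c0 : Pres G) (pres_sum b c0 : Pres G) :=
  pres_copair (pres_comp (pres_inl b c0) h) (pres_inr b c0).

Variable rho : forall c : Pres G, A (pres_sum c c0) -> A c.
Hypothesis rhoB : forall c, zmod_morphism (@rho c).
Hypothesis rhoN : forall (a b : Pres G) (h : hom a b) x,
  rho (fmap A (pres_shift_hom h) x) = fmap A h (rho x).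
Hypothesis rhoK : forall (c : Pres G) (x : A c),
  rho (fmap A (pres_inl c c0 : hom c (pres_sum c c0 : Pres G)) x) = x.

Let pshift := @shift (Pres G) c0 (fun c => pres_sum c c0)
  (fun c => pres_inl c c0) (fun c => pres_inr c c0)
  (fun a b h k => pres_copair h k)
  (fun a b h k => pres_copair_inl h k) (fun a b h k => pres_copair_inr h k)
  (fun a b f g => @pres_sum_eq G a c0 b f g) A.

Let nrho : nattrans pshift A := @nattrans_of _ pshift A rho rhoB rhoN.

Lemma pres_retract_limi (I : injective_resolution A) n (x : limi I n.+1) : x = 0.
Proof.
exact (@retract_limi (Pres G) c0 _ _ _ _ _ _ _ (fun c : Pres G => pres_hom_exists c0 c) _ nrho rhoK I n x).
Qed.

Lemma pres_retract_lim_trivial :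
  (forall c (x : A c0), rho (fmap A (pres_inr c c0 : hom c0 (pres_sum c c0 : Pres G)) x) = 0) ->
  lim_trivial A.
Proof.
exact: (@retract_lim_trivial (Pres G) c0 _ _ _ _ _ _ _ (fun c : Pres G => pres_hom_exists c0 c) _ nrho rhoK).
Qed.

End PresRetract.

Section FIdealSES.
Variables (G : group) (I J : fideal G).
Hypothesis IJ : forall c x, I c x -> J c x.

Definition fideal_incl : nattrans (fideal_functor I) (fideal_functor J).
Proof.
apply: (@NatTrans _ (fideal_functor I) (fideal_functor J)
  (fun c => subgrp_map (phi := idfun) (@IJ c))) => a b h x.
exact: val_inj.
Defined.

Definition fquot_proj : nattrans (fideal_functor J) (fquot J I).
Proof.
apply: (@NatTrans _ (fideal_functor J) (fquot J I)
  (fun c => subquot_class (I c))) => a b h x.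
by rewrite [RHS]fquot_fmapE.
Defined.

Lemma fideal_incl_inj c : injective (fideal_incl c).
Proof. by move=> x y /(congr1 val) /= xy; apply: val_inj. Qed.

Lemma fquot_class_eq0 (V : zmodType) (A B : subgrp V) (x : subgrp_type A) :
  subquot_class B x = 0 <-> B (val x).
Proof.
rewrite -(raddf0 (subquot_class B)) subquot_class_eq.
by rewrite -raddfB subr0.
Qed.

Lemma fquot_proj_exact c x : fquot_proj c x = 0 <-> exists y, fideal_incl c y = x.
Proof.
rewrite [fquot_proj c x]/= fquot_class_eq0; split=> [Ix|[y <-]].
  by exists (subgrp_mk Ix); apply: val_inj.
exact: (subgrp_valP y).
Qed.

Lemma fquot_proj_surj c q : exists x, fquot_proj c x = q.
Proof. by have [x ->] := subquot_classP q; exists x. Qed.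

End FIdealSES.

Section Codes.
Variable G : group.
Local Notation fff := (f_ * f_ * f_ : fideal G)%fid.
Local Notation ffff := (f_ * f_ * f_ * f_ : fideal G)%fid.
Local Notation S := (ffr_rff G).

Definition sum_ffff : fideal G := (ffr_rff G + f_ * f_ * f_ * f_)%fid.
Local Notation W := sum_ffff.

Lemma rel_sub_aug (c : presentation G) x : (r_ : fideal G) c x -> (f_ : fideal G) c x.
Proof. by move=> /= x0; rewrite -(augmentation_map (pmap c)) x0 raddf0. Qed.

Lemma S_sub_fff (c : presentation G) x : S c x -> fff c x.
Proof.
move=> [u [v [Hu Hv ->]]]; apply: smemD.
  by apply: ideal_prodS Hu => // z; exact: rel_sub_aug.
apply: ideal_prodS Hv => // z; apply: ideal_prodS => // {}z; exact: rel_sub_aug.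
Qed.

Lemma S_sub_W (c : presentation G) x : S c x -> W c x.
Proof. by move=> Sx; exists x, 0; rewrite addr0; split=> //; exact: smem0. Qed.

Lemma ffff_sub_W (c : presentation G) x : ffff c x -> W c x.
Proof. by move=> Sx; exists 0, x; rewrite add0r; split=> //; exact: smem0. Qed.

Lemma W_sub_fff (c : presentation G) x : W c x -> fff c x.
Proof.
by move=> [u [v [/S_sub_fff Hu /ffff_sub_fff Hv ->]]]; exact: smemD.
Qed.

Lemma ffr_mem (c : presentation G) x y z :
  f_ c x -> f_ c y -> r_ c z -> S c (x * y * z).
Proof.
move=> fx fy rz; exists (x * y * z), 0; rewrite addr0; split=> //; last exact: smem0.
by do 2 apply: ideal_prodM => //.
Qed.

Lemma rff_mem (c : presentation G) x y z :
  r_ c x -> f_ c y -> f_ c z -> S c (x * y * z).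
Proof.
move=> fx fy rz; exists 0, (x * y * z); rewrite add0r; split=> //; first exact: smem0.
by do 2 apply: ideal_prodM => //.
Qed.

Section Kill.
Variables c0 c : presentation G.

Definition trivial_hom (F H : group) : ghom F H :=
  @GHom F H (fun=> 1%g) (fun _ _ => esym (mulg1 1%g)).

(** Not a morphism over G, unless the second factor maps trivially to G. *)
Definition kill : ghom (pgrp (pres_sum c c0)) (pgrp c) :=
  fp_copair (ghom_id _) (trivial_hom _ _).

Lemma kill_inl x : gr_map kill (gr_map (pres_inl c c0) x) = x.
Proof.
by rewrite -(@gr_map_comp _ _ _ _ _ (ghom_id _)) ?gr_map_id // => y; rewrite fp_copair_inl.
Qed.

Lemma kill_inr x : f_ c0 x -> gr_map kill (gr_map (pres_inr c c0) x) = 0.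
Proof.
move=> /= x0; rewrite -(@gr_map_comp _ _ _ _ _ (trivial_hom _ _)); last first.
  by move=> y; rewrite fp_copair_inr.
have E : gr_map (trivial_hom (pgrp c0) (pgrp c)) x = (augmentation x)%:~R.
  move: x {x0}; apply: gr_ext => [x y|x y|k]; first exact: gr_mapB.
    by rewrite augmentationB mulrzBr.
  by rewrite gr_mapU augmentationU.
by rewrite E x0.
Qed.

Lemma kill_fff x : fff (pres_sum c c0) x -> fff c (gr_map kill x).
Proof.
move=> H; pose B := preim_subgrp (gr_map kill : {additive _ -> _}) (fff c).
apply: (@ideal_prod3_ind _ _ _ _ B _ _ H) => u v w Hu Hv Hw.
rewrite /B /= !rmorphM.
by apply: ideal_prodM; [apply: ideal_prodM|]; rewrite /= augmentation_map.
Qed.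

End Kill.

Lemma kill_natural c0 (a b : Pres G) (h : hom a b) x :
  gr_map (kill c0 b) (gr_map (pres_shift_hom c0 h) x) = gr_map h (gr_map (kill c0 a) x).
Proof.
pose l := ghom_comp h (kill c0 a).
rewrite -(@gr_map_comp _ _ _ h (kill c0 a) l) // -(@gr_map_comp _ _ _ _ _ l) //.
move=> y; symmetry; move: y.
apply: (@fp_hom_eq _ _ _ (ghom_comp (kill c0 b) (pres_shift_hom c0 h)) l) => y.
  transitivity (kill c0 b (pres_inl b c0 (h y))).
    by congr (kill c0 b _); exact: fp_copair_inl.
  rewrite [LHS]fp_copair_inl; congr (h _); symmetry; exact: fp_copair_inl.
transitivity (kill c0 b (pres_inr b c0 y)).
  by congr (kill c0 b _); exact: fp_copair_inr.
rewrite [LHS]fp_copair_inr -[LHS](ghom1 h); congr (h _); symmetry.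
exact: fp_copair_inr.
Qed.

Lemma fff_lim_trivial : lim_trivial (fideal_functor fff).
Proof.
have [c0] := presentation_exists G.
apply: (@pres_retract_lim_trivial G c0 (fideal_functor fff)
  (fun c => subgrp_map (phi := gr_map (kill c0 c)) (@kill_fff c0 c))).
- by move=> c x y; rewrite raddfB.
- by move=> a b h x; apply: val_inj; exact: kill_natural.
- by move=> c x; apply: val_inj; exact: kill_inl.
move=> c x; apply: val_inj.
change (gr_map (kill c0 c) (gr_map (pres_inr c c0) (val x)) = 0).
have := subgrp_valP x; move: (val x) => z H.
pose B := preim_subgrp (gr_map (kill c0 c) : {additive _ -> _})
  (zero_subgrp (group_ring (pgrp c))).
pose B' := preim_subgrp (gr_map (pres_inr c c0) : {additive _ -> _}) B.
apply: (@ideal_prod3_ind _ _ _ _ B' _ _ H) => u v w Hu Hv Hw.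
change (gr_map (kill c0 c) (gr_map (pres_inr c c0) (u * v * w)) = 0).
by rewrite !rmorphM [X in X * _ * _]kill_inr // !mul0r.
Qed.

End Codes.

(** * The retraction of fff / W *)

Lemma gr_mapM (F H : group) (h : ghom F H) : {morph gr_map h : x y / x * y}.
Proof. exact: rmorphM. Qed.

Lemma rel_hom_diff (G : group) (c d : presentation G) (k l : pres_hom c d) x :
  r_ d (gr_map k x - gr_map l x).
Proof.
have E (m : pres_hom c d) : gr_map (pmap d) (gr_map m x) = gr_map (pmap c) x.
  exact/esym/gr_map_comp/(fun y => esym (phom_over m y)).
change (gr_map (pmap d) (gr_map k x - gr_map l x) = 0).
exact: etrans (gr_mapB _ _ _) (etrans (congr2 (fun u v => u - v) (E k) (E l)) (subrr _)).
Qed.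

Lemma smem_congr (V : zmodType) (A : subgrp V) x y : A (x - y) -> A y -> A x.
Proof. by move=> Axy Ay; rewrite -[x](subrK y); apply: smemD. Qed.

Lemma smem_congr4 (V : zmodType) (A : subgrp V) x y z t :
  A (x - y) -> A (y - t) -> A (z - t) -> A (x - z).
Proof.
move=> Axy Ayt Azt; rewrite (_ : x - z = (x - y) + (y - t) - (z - t)).
  by apply: smemB => //; apply: smemD.
by rewrite addrA subrK opprB addrA subrK.
Qed.

Lemma smem_mul3 (R : nzRingType) (A : subgrp R) (p p' q r r' : R) :
  A ((p - p') * q * r) -> A (p' * q * (r - r')) -> A (p * q * r - p' * q * r').
Proof.
by move=> Hp Hr; rewrite mul3_telescope subrr mulr0 mul0r addr0; exact: smemD.
Qed.

Section MiddleRetraction.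
Variables (G : group) (c0 : Pres G).
Local Notation fff := (f_ * f_ * f_ : fideal G)%fid.
Local Notation S := (ffr_rff G).
Local Notation W := (sum_ffff G).

Section At.
Variable c : Pres G.
Let P : presentation G := pres_sum c c0.

(** A retraction of the first summand over G; the choice on the second summand
    does not matter modulo S. *)
Definition fold_hom : pres_hom P c :=
  pres_copair (pres_id c) (inhabited_witness (pres_hom_exists c0 c)).

Lemma fold_inl x : gr_map fold_hom (gr_map (pres_inl c c0) x) = x.
Proof.
rewrite -(@gr_map_comp _ _ _ _ _ (pres_comp fold_hom (pres_inl c c0))) //.
by rewrite [fold_hom]/fold_hom pres_copair_inl gr_map_id.
Qed.

(** The homomorphisms applied to the three factors of a product: fold, kill and
    fold. *)
Definition middle_homs (n : nat) : ghom (pgrp P) (pgrp c) :=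
  if n == 1%N then kill c0 c else fold_hom.

Definition middle : {additive group_ring (pgrp P) -> group_ring (pgrp c)} :=
  projT1 (cid (triple_product_map middle_homs (pgrp_free P))).

Lemma middle_ffff x : (f_ * f_ * f_ * f_)%fid P x -> middle x = 0.
Proof. exact: (projT2 (cid (triple_product_map middle_homs (pgrp_free P)))).1. Qed.

Lemma middleE x y z : f_ P x -> f_ P y -> f_ P z ->
  W c (middle (x * y * z) -
       gr_map fold_hom x * gr_map (kill c0 c) y * gr_map fold_hom z).
Proof.
move=> fx fy fz; apply: ffff_sub_W.
exact: (projT2 (cid (triple_product_map middle_homs (pgrp_free P)))).2.
Qed.

Lemma middle_fff x : fff P x -> fff c (middle x).
Proof.
move=> H; pose B := preim_subgrp middle (fff c).
apply: (@ideal_prod3_ind _ _ _ _ B _ _ H) => u v w fu fv fw; rewrite /B /=.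
apply: (smem_congr (W_sub_fff (middleE fu fv fw))).
by apply: ideal_prodM; [apply: ideal_prodM|]; rewrite /= augmentation_map.
Qed.

(** ffff is killed, and the outer factors are mapped over G, so that a factor in r
    stays in r. *)
Lemma middle_W x : W P x -> W c (middle x).
Proof.
move=> [s [t [[u [v [Hu Hv ->]]] Ht ->]]]; rewrite raddfD (middle_ffff Ht) addr0 raddfD.
pose B := preim_subgrp middle (W c).
have step p q r : f_ P p -> f_ P q -> f_ P r ->
    S c (gr_map fold_hom p * gr_map (kill c0 c) q * gr_map fold_hom r) -> B (p * q * r).
  move=> fx fy fz Sxyz; rewrite /B /=.
  by apply: (smem_congr (middleE fx fy fz)); exact: S_sub_W.
apply: smemD.
  apply: (@ideal_prod3_ind _ _ _ _ B _ _ Hu) => x1 y1 z1 fx fy rz.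
  apply: step => //; first exact: rel_sub_aug.
  apply: ffr_mem; [exact: aug_fideal_map | by rewrite /= augmentation_map |].
  exact: rel_fideal_map.
apply: (@ideal_prod3_ind _ _ _ _ B _ _ Hv) => x1 y1 z1 rx fy fz.
apply: step => //; first exact: rel_sub_aug.
apply: rff_mem; [exact: rel_fideal_map | by rewrite /= augmentation_map |].
exact: aug_fideal_map.
Qed.

Definition middle_map : {additive fquot fff W P -> fquot fff W c} :=
  subquot_map middle_fff middle_W.

Lemma middle_mapE x :
  middle_map (subquot_class (W P) x) = subquot_class (W c) (subgrp_map middle_fff x).
Proof. exact: subquot_mapE. Qed.

Lemma middle_inl (x : fquot fff W c) :
  middle_map (fmap (fquot fff W) (pres_inl c c0 : hom c (P : Pres G)) x) = x.
Proof.
have [y ->] := subquot_classP x; rewrite [fmap _ _ _]fquot_fmapE middle_mapE.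
apply/subquot_class_eq.
change (W c (middle (gr_map (pres_inl c c0) (val y)) - val y)).
have := subgrp_valP y; move: (val y) => z Hz.
have dB : zmod_morphism (fun z => middle (gr_map (pres_inl c c0) z) - z).
  by move=> u v; rewrite gr_mapB raddfB !opprD addrACA.
apply: (@ideal_prod3_ind _ _ _ _ (preim_subgrp (additive_of dB) (W c)) _ _ Hz) => u v w fu fv fw.
change (W c (middle (gr_map (pres_inl c c0) (u * v * w)) - u * v * w)).
have fi t : f_ c t -> f_ P (gr_map (pres_inl c c0) t) by exact: aug_fideal_map.
rewrite !rmorphM -{2}(fold_inl u) -{2}(kill_inl c0 v) -{2}(fold_inl w).
exact: (middleE (fi _ fu) (fi _ fv) (fi _ fw)).
Qed.

Lemma middle_inr (x : fquot fff W c0) :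
  middle_map (fmap (fquot fff W) (pres_inr c c0 : hom c0 (P : Pres G)) x) = 0.
Proof.
have [y ->] := subquot_classP x; rewrite [fmap _ _ _]fquot_fmapE middle_mapE.
apply/fquot_class_eq0.
change (W c (middle (gr_map (pres_inr c c0) (val y)))).
have := subgrp_valP y; move: (val y) => z Hz.
pose B := preim_subgrp (gr_map (pres_inr c c0) : {additive _ -> _}) (preim_subgrp middle (W c)).
apply: (@ideal_prod3_ind _ _ _ _ B _ _ Hz) => u v w fu fv fw.
change (W c (middle (gr_map (pres_inr c c0) (u * v * w)))).
have fi t : f_ c0 t -> f_ P (gr_map (pres_inr c c0) t) by exact: aug_fideal_map.
have := middleE (fi _ fu) (fi _ fv) (fi _ fw).
by rewrite kill_inr // mulr0 mul0r subr0 !rmorphM.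
Qed.

End At.

(** Changing the order of h and fold changes the outer factors by elements of r,
    while kill commutes with h on the nose. *)
Lemma middle_natural (a b : Pres G) (h : hom a b) (x : fquot fff W (pres_sum a c0)) :
  middle_map b (fmap (fquot fff W) (pres_shift_hom c0 h) x) =
  fmap (fquot fff W) h (middle_map a x).
Proof.
have [y ->] := subquot_classP x.
rewrite [fmap _ (pres_shift_hom _ _) _]fquot_fmapE !middle_mapE [RHS]fquot_fmapE.
apply/subquot_class_eq.
change (W b (middle b (gr_map (pres_shift_hom c0 h) (val y)) - gr_map h (middle a (val y)))).
have := subgrp_valP y; move: (val y) => z Hz.
have dB : zmod_morphism (fun z => middle b (gr_map (pres_shift_hom c0 h) z) -
    gr_map h (middle a z)).
  move=> u v; rewrite (gr_mapB (pres_shift_hom c0 h)) [middle b (_ - _)]raddfB.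
  by rewrite [middle a (_ - _)]raddfB (gr_mapB h) !opprD addrACA.
apply: (@ideal_prod3_ind _ _ _ _ (preim_subgrp (additive_of dB) (W b)) _ _ Hz) => u v w fu fv fw.
change (W b (middle b (gr_map (pres_shift_hom c0 h) (u * v * w)) -
   gr_map h (middle a (u * v * w)))).
pose s := gr_map (pres_shift_hom c0 h).
have fs t : f_ (pres_sum a c0) t -> f_ (pres_sum b c0) (s t) by exact: aug_fideal_map.
pose t1 := gr_map (fold_hom b) (s u) * gr_map (kill c0 b) (s v) * gr_map (fold_hom b) (s w).
pose t2 := gr_map (fold_hom a) u * gr_map (kill c0 a) v * gr_map (fold_hom a) w.
have E1 : W b (middle b (s (u * v * w)) - t1).
  by rewrite /s !rmorphM; exact: middleE (fs _ fu) (fs _ fv) (fs _ fw).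
have E2 : W b (gr_map h (middle a (u * v * w)) - gr_map h t2).
  by rewrite -gr_mapB; apply: fideal_map; exact: middleE.
have diff t : r_ b (gr_map (fold_hom b) (s t) - gr_map h (gr_map (fold_hom a) t)).
  rewrite /s -(@gr_map_comp _ _ _ _ _ (pres_comp (fold_hom b) (pres_shift_hom c0 h))) //.
  rewrite -(@gr_map_comp _ _ _ _ _ (pres_comp h (fold_hom a))) //.
  exact: rel_hom_diff.
have E3 : W b (t1 - gr_map h t2).
  have -> : gr_map h t2 = gr_map h (gr_map (fold_hom a) u) *
      gr_map (kill c0 b) (s v) * gr_map h (gr_map (fold_hom a) w).
    by rewrite /s (kill_natural h) /t2 !gr_mapM.
  apply: smem_mul3.
    apply/S_sub_W/rff_mem; [exact: diff | | exact: aug_fideal_map (fs _ fw)].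
    by rewrite /= !augmentation_map.
  apply/S_sub_W/ffr_mem; [| | exact: diff].
    by rewrite /= !augmentation_map.
  by rewrite /= !augmentation_map.
exact: (smem_congr4 E1 E3 E2).
Qed.

Lemma middle_lim_trivial : lim_trivial (fquot fff W).
Proof.
apply: (@pres_retract_lim_trivial G c0 (fquot fff W) middle_map).
- by move=> c x y; rewrite raddfB.
- exact: middle_natural.
- exact: middle_inl.
- exact: middle_inr.
Qed.

End MiddleRetraction.

Lemma sum_ffff_lim_trivial (G : group) : lim_trivial (fideal_functor (sum_ffff G)).
Proof.
have [c0] := presentation_exists G.
apply: (@ses_lim_trivial _ _ _ _ (fideal_incl (@W_sub_fff G)) (fquot_proj _ _)).
- exact: fideal_incl_inj.
- exact: fquot_proj_exact.
- exact: fquot_proj_surj.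
- exact: fff_lim_trivial.
- exact: (middle_lim_trivial c0).
Qed.

(** * Maps out of a tensor product *)

Lemma inj_surj_bij (T U : Type) (f : T -> U) :
  injective f -> (forall y, exists x, f x = y) -> bijective f.
Proof.
move=> f_inj f_surj; pose g y := projT1 (cid (f_surj y)).
have gK y : f (g y) = y := projT2 (cid (f_surj y)).
by exists g => // x; apply: f_inj.
Qed.

Section PreimageSubgrp.
Variables (V W : zmodType) (phi : {additive V -> W}) (A : subgrp W).

Lemma preimage_mem0 : A (phi 0).
Proof. by rewrite raddf0; exact: smem0. Qed.

Lemma preimage_memB x y : A (phi x) -> A (phi y) -> A (phi (x - y)).
Proof. by rewrite raddfB; exact: smemB. Qed.

Definition preimage_subgrp : subgrp V := SubGrp preimage_mem0 preimage_memB.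

End PreimageSubgrp.

Section TensorMaps.
Variables (R : nzRingType) (M N : zmodType).
Variables (ract : M -> R -> M) (lact : R -> N -> N).
Local Notation T := (tensor ract lact).

Definition tensor_pi : {additive {malg int[(M * N)%type]} -> T} :=
  \pi_(Quotient.quot (smemb (gen_subgrp (tensor_rel ract lact))))%qT.

Lemma tensor_pi_eq x y :
  tensor_pi x = tensor_pi y -> gen_subgrp (tensor_rel ract lact) (x - y).
Proof. by move=> /eqP; rewrite -Quotient.idealrBE => /smembP. Qed.

Lemma tensor_piP (q : T) : exists x, q = tensor_pi x.
Proof. by exists (repr q); rewrite /tensor_pi /= reprK. Qed.

Lemma tensor_ind (A : subgrp T) : (forall m n, A (tens ract lact m n)) -> forall q, A q.
Proof.
move=> At q; have [x ->] := tensor_piP q; rewrite [x]monalgE raddf_sum.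
apply/smembP/rpred_sum => -[m n] _; rewrite malgUz raddfMz.
by apply: rpredMz; apply/smembP/At.
Qed.

Section Lift.
Variables (V : zmodType) (phi : M -> N -> V).
Hypothesis phiDl : forall m m' n, phi (m + m') n = phi m n + phi m' n.
Hypothesis phiDr : forall m n n', phi m (n + n') = phi m n + phi m n'.
Hypothesis phiA : forall m a n, phi (ract m a) n = phi m (lact a n).

Let lin : {additive {malg int[(M * N)%type]} -> V} :=
  linext (fun p : M * N => phi p.1 p.2).

Let linU p : lin << p >> = phi p.1 p.2.
Proof. by rewrite /lin /= linextU mulr1z. Qed.

Lemma lin_rel x : gen_subgrp (tensor_rel ract lact) x -> lin x = 0.
Proof.
move=> H; apply: (H (ker_subgrp lin)) => _ [m m' n|m n n'|m a n] /=;
  by rewrite raddfB ?raddfD !linU /= ?phiDl ?phiDr ?phiA -?opprD subrr.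
Qed.

Definition tensor_lift_fun (q : T) : V := lin (repr q).

Lemma tensor_lift_pi x : tensor_lift_fun (tensor_pi x) = lin x.
Proof.
apply/eqP; rewrite -subr_eq0 -raddfB; apply/eqP/lin_rel/tensor_pi_eq.
by rewrite /tensor_pi /= reprK.
Qed.

Lemma tensor_lift_funB : zmod_morphism tensor_lift_fun.
Proof.
move=> p q; have [x ->] := tensor_piP p; have [y ->] := tensor_piP q.
by rewrite -raddfB !tensor_lift_pi raddfB.
Qed.

Definition tensor_lift : {additive T -> V} := additive_of tensor_lift_funB.

Lemma tensor_liftE m n : tensor_lift (tens ract lact m n) = phi m n.
Proof. exact: etrans (tensor_lift_pi _) (linU _). Qed.

End Lift.

End TensorMaps.

(** * Functors on which parallel morphisms agree *)

Section Rigid.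
Variables (G : group) (A : abfunctor (Pres G)).

(** In Pres(G) any two objects are connected in both directions, so this property
    is equivalent to being constant. *)
Definition rigid : Prop :=
  forall (a b : Pres G) (h k : hom a b) x, fmap A h x = fmap A k x.

Definition pres_pick (a b : Pres G) : hom a b :=
  inhabited_witness (pres_hom_exists a b).

Hypothesis Arigid : rigid.

Lemma rigid_endo (a : Pres G) (h : hom a a) x : fmap A h x = x.
Proof. by rewrite (Arigid h (idm a)) fmap_id. Qed.

Lemma rigid_constant : is_constant A.
Proof.
have [c0] := presentation_exists G.
exists (A c0).
have tN (a b : Pres G) (h : hom a b) (x : A a) :
    fmap A (pres_pick b c0) (fmap A h x) = fmap A (pres_pick a c0) x.
  by rewrite -fmap_comp; exact: Arigid.
exists (@NatTrans _ A (const_functor (Pres G) (A c0))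
  (fun c => fmap A (pres_pick c c0)) tN) => c /=.
exists (fmap A (pres_pick c0 c)) => x; rewrite -fmap_comp; exact: rigid_endo.
Qed.

(** Any morphism from c + c0 to c induces a retraction, natural by rigidity. *)
Lemma rigid_limi (I : injective_resolution A) n (x : limi I n.+1) : x = 0.
Proof.
have [c0] := presentation_exists G.
apply: (@pres_retract_limi G c0 A (fun c => fmap A (pres_pick (pres_sum c c0) c))).
- by move=> c y z; rewrite raddfB.
- by move=> a b h y; rewrite -!fmap_comp; exact: Arigid.
- by move=> c y; rewrite -fmap_comp; exact: rigid_endo.
Qed.

Lemma rigid_compatible (c : Pres G) (x : A c) :
  compatible (fun d => fmap A (pres_pick c d) x).
Proof. by move=> a b h; rewrite -fmap_comp; exact: Arigid. Qed.

Definition rigid_lim_fun (c : Pres G) (x : A c) : lim A := Lim (rigid_compatible x).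

Lemma rigid_lim_funB c : zmod_morphism (@rigid_lim_fun c).
Proof. by move=> x y; apply: limP => d /=; rewrite raddfB. Qed.

Definition rigid_lim c : {additive A c -> lim A} := additive_of (@rigid_lim_funB c).

Lemma rigid_lim_bij c : bijective (rigid_lim c).
Proof.
exists (fun z : lim A => z c) => [x|z]; first exact: rigid_endo.
by apply: limP => d; exact: lim_valP.
Qed.

End Rigid.

Lemma rigid_surj (G : group) (A B : abfunctor (Pres G)) (t : nattrans A B) :
  (forall c y, exists x, t c x = y) -> rigid A -> rigid B.
Proof.
move=> t_surj Ar a b h k y; have [x <-] := t_surj a y.
by rewrite -!ntmapE (Ar _ _ h k).
Qed.

(** * The tensor square of g^2 and its image *)

Lemma mul2_telescope (R : nzRingType) (x y x' y' : R) :
  x * y - x' * y' = x' * (y - y') + (x - x') * y.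
Proof. by rewrite mulrBr mulrBl [RHS]addrC addrA subrK. Qed.

Section GSquared.
Variable G : group.
Local Notation ff := (f_ * f_ : fideal G)%fid.
Local Notation fff := (f_ * f_ * f_ : fideal G)%fid.
Local Notation ffff := (f_ * f_ * f_ * f_ : fideal G)%fid.
Local Notation S := (ffr_rff G).
Local Notation W := (sum_ffff G).
Local Notation Q := (fquot ffff (S :&: ffff)%fid).
Local Notation g2 := (g2 G).

Section At.
Variable c : Pres G.
Local Notation p := (gr_map (pmap c)).

Lemma gr_map_surj y : exists x, p x = y.
Proof.
apply: (@gr_subgrp_full _ (im_subgrp p)) => k.
by have [x <-] := pmap_epi c k; exists (gr_of x); exact: gr_mapU.
Qed.

Lemma aug_lift y : aug_ideal G y -> exists2 x, f_ c x & p x = y.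
Proof.
by move=> y0; have [x xy] := gr_map_surj y; exists x => //=; rewrite -(augmentation_map (pmap c)) xy.
Qed.

Lemma g2_lift y : g2 y -> exists2 x, ff c x & p x = y.
Proof.
move=> Hy.
have vB : zmod_morphism (fun x : subgrp_type (ff c) => p (val x)).
  by move=> u v; rewrite raddfB.
have [x xE] : im_subgrp (additive_of vB) y.
  apply: (@ideal_prod_ind _ _ _ (im_subgrp (additive_of vB)) _ _ Hy) => u v fu fv.
  have [x fx <-] := aug_lift fu; have [x' fx' <-] := aug_lift fv.
  exists (subgrp_mk (ideal_prodM fx fx') : subgrp_type (ff c)).
  by rewrite -gr_mapM.
by exists (val x) => //; exact: subgrp_valP.
Qed.

Lemma ff_to_g2_bij : bijective (ff_to_g2 G c).
Proof.
apply: inj_surj_bij => [q q'|y].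
  have [x ->] := subquot_classP q; have [x' ->] := subquot_classP q'.
  rewrite [ff_to_g2 _ _ _]ff_to_g2E [RHS]ff_to_g2E => /(congr1 val) E.
  apply/subquot_class_eq; split; last by apply: smemB; exact: subgrp_valP.
  change (p (val x - val x') = 0); rewrite gr_mapB.
  by apply/eqP; rewrite subr_eq0; apply/eqP.
have [x fx xy] := g2_lift (subgrp_valP y).
exists (scls ((r_ :&: f_ * f_)%fid c) fx).
by rewrite [LHS]ff_to_g2E; apply: val_inj.
Qed.

(** x y - x' y' = x' (y - y') + (x - x') y lies in ff.r + r.ff. *)
Lemma ffM_diff x y x' y' : ff c x -> ff c y -> ff c x' -> ff c y' ->
  p x = p x' -> p y = p y' -> S c (x * y - x' * y').
Proof.
move=> fx fy fx' fy' xx' yy'.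
have r u v : p u = p v -> r_ c (u - v).
  by move=> uv; change (p (u - v) = 0); rewrite gr_mapB uv; exact: subrr.
rewrite mul2_telescope.
exists (x' * (y - y')), ((x - x') * y); split=> //.
  by apply: ideal_prodM => //; exact: r.
by apply/ideal_prodA/ideal_prodM => //; exact: r.
Qed.

(** A lift along ff -> g^2, which is not additive; [g2_mulE] makes the choice
    irrelevant. *)
Definition g2_section (a : subgrp_type g2) : subgrp_type (ff c) :=
  let: exist2 x fx _ := cid2 (g2_lift (subgrp_valP a)) in subgrp_mk fx.

Lemma g2_sectionE a : p (val (g2_section a)) = val a.
Proof. by rewrite /g2_section; case: cid2. Qed.

Definition g2_mul (a b : subgrp_type g2) : fquot fff S c :=
  scls (S c) (fff_of_ffM (subgrp_valP (g2_section a)) (subgrp_valP (g2_section b))).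

Lemma g2_mulE a b x y (fx : ff c x) (fy : ff c y) (H : fff c (x * y)) :
  p x = val a -> p y = val b -> g2_mul a b = scls (S c) H.
Proof.
move=> xa yb; apply/subquot_class_eq; apply: ffM_diff => //; try exact: subgrp_valP.
  by rewrite g2_sectionE xa.
by rewrite g2_sectionE yb.
Qed.

Lemma scls_add (V : zmodType) (A B : subgrp V) x y (Ax : A x) (Ay : A y) (Axy : A (x + y)) :
  scls B Axy = scls B Ax + scls B Ay.
Proof. by rewrite /scls -raddfD; congr subquot_class; apply: val_inj. Qed.

Lemma scls_eq (V : zmodType) (A B : subgrp V) x y (Ax : A x) (Ay : A y) :
  x = y -> scls B Ax = scls B Ay.
Proof. by move=> xy; apply/subquot_class_eq; rewrite /= xy subrr; exact: smem0. Qed.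

Lemma g2_mulDl a a' b : g2_mul (a + a') b = g2_mul a b + g2_mul a' b.
Proof.
have [x fx xa] := g2_lift (subgrp_valP a).
have [x' fx' xa'] := g2_lift (subgrp_valP a').
have [y fy yb] := g2_lift (subgrp_valP b).
rewrite (g2_mulE fx fy (fff_of_ffM fx fy) xa yb).
rewrite (g2_mulE fx' fy (fff_of_ffM fx' fy) xa' yb).
rewrite (@g2_mulE _ _ (x + x') y _ _ (fff_of_ffM (smemD fx fx') fy)) //.
- rewrite -(scls_add _ _ _ (smemD (fff_of_ffM fx fy) (fff_of_ffM fx' fy))).
  by apply: scls_eq; exact: mulrDl.
- exact: smemD.
- by rewrite !raddfD /= -xa -xa'.
Qed.

Lemma g2_mulDr a b b' : g2_mul a (b + b') = g2_mul a b + g2_mul a b'.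
Proof.
have [x fx xa] := g2_lift (subgrp_valP a).
have [y fy yb] := g2_lift (subgrp_valP b).
have [y' fy' yb'] := g2_lift (subgrp_valP b').
rewrite (g2_mulE fx fy (fff_of_ffM fx fy) xa yb).
rewrite (g2_mulE fx fy' (fff_of_ffM fx fy') xa yb').
rewrite (@g2_mulE _ _ x (y + y') _ _ (fff_of_ffM fx (smemD fy fy'))) //.
- rewrite -(scls_add _ _ _ (smemD (fff_of_ffM fx fy) (fff_of_ffM fx fy'))).
  by apply: scls_eq; exact: mulrDr.
- exact: smemD.
- by rewrite !raddfD /= -yb -yb'.
Qed.

Lemma g2_mulA a g b : g2_mul (ideal_ract a g) b = g2_mul a (ideal_lact g b).
Proof.
have [x fx xa] := g2_lift (subgrp_valP a).
have [y fy yb] := g2_lift (subgrp_valP b).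
have [t tg] := gr_map_surj g.
have fxt : ff c (x * t) by exact: idealMr.
have fty : ff c (t * y) by exact: idealMl.
rewrite (@g2_mulE _ _ (x * t) y _ _ (fff_of_ffM fxt fy)) //; last first.
  by rewrite gr_mapM xa tg.
rewrite (@g2_mulE _ _ x (t * y) _ _ (fff_of_ffM fx fty)) //; last first.
  by rewrite gr_mapM yb tg.
by apply: scls_eq; rewrite mulrA.
Qed.

Definition mu_at : {additive ideal_tensor g2 g2 -> fquot fff S c} :=
  tensor_lift g2_mulDl g2_mulDr g2_mulA.

Lemma mu_atE a b x y (fx : ff c x) (fy : ff c y) :
  p x = val a -> p y = val b ->
  mu_at (ideal_tens a b) = scls (S c) (fff_of_ffM fx fy).
Proof. by move=> xa yb; rewrite [LHS]tensor_liftE; exact: g2_mulE. Qed.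

Lemma ff_to_g2_scls x (fx : ff c x) :
  val (ff_to_g2 G c (scls ((r_ :&: f_ * f_)%fid c) fx)) = p x.
Proof. by rewrite [ff_to_g2 _ _ _]ff_to_g2E. Qed.

End At.

Lemma mu_natural (a b : Pres G) (h : hom a b) t :
  mu_at b t = fmap (fquot fff S) h (mu_at a t).
Proof.
have dB : zmod_morphism (fun t => mu_at b t - fmap (fquot fff S) h (mu_at a t)).
  move=> u v; rewrite [mu_at b _]raddfB [mu_at a _]raddfB [fmap _ _ (_ - _)]raddfB.
  by rewrite opprD addrACA -opprD.
apply/eqP; rewrite -subr_eq0; apply/eqP.
apply: (@tensor_ind _ _ _ _ _ (ker_subgrp (additive_of dB))) => m n.
change (mu_at b (ideal_tens m n) -
  fmap (fquot fff S) h (mu_at a (ideal_tens m n)) = 0).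
apply/eqP; rewrite subr_eq0; apply/eqP.
have [x fx xm] := g2_lift a (subgrp_valP m).
have [y fy yn] := g2_lift a (subgrp_valP n).
have pE z : gr_map (pmap b) (gr_map h z) = gr_map (pmap a) z.
  exact/esym/gr_map_comp/(fun y => esym (phom_over h y)).
have fhx := fideal_map h fx; have fhy := fideal_map h fy.
rewrite (mu_atE fx fy xm yn).
rewrite (@mu_atE b m n _ _ fhx fhy) ?pE //.
rewrite [RHS]fquot_fmapE; apply/subquot_class_eq.
change (S b (gr_map h x * gr_map h y - gr_map h (x * y))).
by rewrite gr_mapM subrr; exact: smem0.
Qed.

Definition mu : nattrans (const_functor (Pres G) (ideal_tensor g2 g2)) (fquot fff S) :=
  @NatTrans _ (const_functor (Pres G) (ideal_tensor g2 g2)) (fquot fff S) mu_at mu_natural.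

Lemma ffff_to_fffE c x (Hx : ffff c x) :
  ffff_to_fff G c (scls ((S :&: ffff)%fid c) Hx) = scls (S c) (ffff_sub_fff Hx).
Proof.
by rewrite [LHS]fquot_incl_atE; congr subquot_class; apply: val_inj.
Qed.

Lemma ffff_to_fff_inj c : injective (ffff_to_fff G c).
Proof.
move=> q q'; have [x ->] := subquot_classP q; have [x' ->] := subquot_classP q'.
rewrite [ffff_to_fff _ _ _]fquot_incl_atE [RHS]fquot_incl_atE => /subquot_class_eq Sxy.
by apply/subquot_class_eq; split=> //; apply: smemB; exact: subgrp_valP.
Qed.

Lemma ffff_mul (c : presentation G) x y : ff c x -> ff c y -> ffff c (x * y).
Proof. by move=> fx fy; apply/ideal_prodA/ideal_prodM. Qed.

Lemma scls_sub (V : zmodType) (A B : subgrp V) x y (Ax : A x) (Ay : A y) :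
  scls B (smemB Ax Ay) = scls B Ax - scls B Ay.
Proof. by rewrite /scls -raddfB; congr subquot_class; apply: val_inj. Qed.

Lemma ffff_to_fff_im c q : im_subgrp (mu c) (ffff_to_fff G c q).
Proof.
pose P z := exists fz : fff c z, im_subgrp (mu c) (scls (S c) fz).
have P0 : P 0.
  exists (smem0 (fff c)); exists 0; rewrite raddf0; apply/esym/fquot_class_eq0.
  exact: (smem0 (S c)).
have PB x y : P x -> P y -> P (x - y).
  move=> [fx [t tE]] [fy [u uE]]; exists (smemB fx fy), (t - u).
  by rewrite raddfB tE uE scls_sub.
have [x ->] := subquot_classP q; have Hx := subgrp_valP x.
have -> : ffff_to_fff G c (subquot_class _ x) = scls (S c) (ffff_sub_fff Hx).
  by rewrite [LHS]fquot_incl_atE; congr subquot_class; apply: val_inj.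
have [fx [t tE]] : P (val x).
  apply: (@ideal_prod_ind _ (ff c) (ff c) (SubGrp P0 PB)).
    move=> u v fu fv; exists (fff_of_ffM fu fv).
    exists (ideal_tens (subgrp_mk (ff_map_g2 fu)) (subgrp_mk (ff_map_g2 fv))).
    exact: mu_atE.
  exact/ideal_prodA.
by exists t; rewrite tE; exact: scls_eq.
Qed.

Lemma mu_im_ffff c t : exists q, ffff_to_fff G c q = mu c t.
Proof.
apply: (@tensor_ind _ _ _ _ _ (preimage_subgrp (mu c) (im_subgrp (ffff_to_fff G c)))).
move=> m n; have [x fx xm] := g2_lift c (subgrp_valP m).
have [y fy yn] := g2_lift c (subgrp_valP n).
exists (scls ((S :&: ffff)%fid c) (ffff_mul fx fy)).
rewrite ffff_to_fffE -[RHS]/(mu_at c (ideal_tens m n)) (mu_atE fx fy xm yn).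
exact: scls_eq.
Qed.

(** Q embeds into fff / S with image that of [mu], and the source of [mu] is
    constant. *)
Lemma Q_rigid : rigid Q.
Proof.
move=> a b h k q; apply: ffff_to_fff_inj; rewrite !ntmapE.
by have [t <-] := ffff_to_fff_im q; rewrite -!ntmapE.
Qed.

Definition to_image_mu_fun c (q : Q c) : image_functor mu c :=
  subgrp_mk (ffff_to_fff_im q).

Lemma to_image_mu_funB c : zmod_morphism (@to_image_mu_fun c).
Proof. by move=> x y; apply: val_inj; exact: (raddfB (ffff_to_fff G c)). Qed.

Lemma to_image_mu_natural (a b : Pres G) (h : hom a b) (x : Q a) :
  to_image_mu_fun (fmap Q h x) = fmap (image_functor mu) h (to_image_mu_fun x).
Proof. by apply: val_inj; exact: (ntmapE (ffff_to_fff G) h x). Qed.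

Definition to_image_mu : nattrans Q (image_functor mu) :=
  nattrans_of to_image_mu_funB to_image_mu_natural.

Lemma to_image_mu_bij c : bijective (to_image_mu c).
Proof.
apply: inj_surj_bij => [q q' /(congr1 val)|y]; first exact: ffff_to_fff_inj.
have [t tE] := subgrp_valP y; have [q qE] := mu_im_ffff t.
by exists q; apply: val_inj; rewrite -tE -qE.
Qed.

Definition Q_to_W : nattrans Q (fquot W S) :=
  fquot_incl (@ffff_sub_W G) (@cap_ffff_sub G).

Lemma Q_to_W_inj c : injective (Q_to_W c).
Proof.
move=> q q'; have [x ->] := subquot_classP q; have [x' ->] := subquot_classP q'.
rewrite [Q_to_W _ _]fquot_incl_atE [RHS]fquot_incl_atE => /subquot_class_eq Sxy.
by apply/subquot_class_eq; split=> //; apply: smemB; exact: subgrp_valP.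
Qed.

Lemma Q_to_W_surj c y : exists q, Q_to_W c q = y.
Proof.
have [w ->] := subquot_classP y; have [s [z [Ss fz wE]]] := subgrp_valP w.
exists (scls ((S :&: ffff)%fid c) fz); rewrite [LHS]fquot_incl_atE.
apply/subquot_class_eq; change (S c (z - val w)).
by rewrite wE opprD addrCA subrr addr0; exact: smemN.
Qed.

Lemma fquot_WS_rigid : rigid (fquot W S).
Proof. exact: rigid_surj Q_to_W_surj Q_rigid. Qed.

Lemma limi_S (I : injective_resolution (fideal_functor S)) :
  (forall c, ab_isomorphic (limi I 1) (Q c)) /\
  (forall i, (2 <= i)%N -> forall x : limi I i, x = 0).
Proof.
pose L := std_resolution (fquot W S).
have inc := @fideal_incl_inj _ _ _ (@S_sub_W G).
have ex := @fquot_proj_exact _ _ _ (@S_sub_W G).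
have su := @fquot_proj_surj _ S W.
have Wt := @sum_ffff_lim_trivial G.
split=> [c|[|[|n]] // _ x]; last first.
  exact: (shift_vanishing inc ex su Wt (@rigid_limi _ _ fquot_WS_rigid L n)).
pose e : {additive Q c -> lim (fquot W S)} := rigid_lim fquot_WS_rigid c \o Q_to_W c.
have e_bij : bijective e.
  apply: bij_comp (rigid_lim_bij _ _) _.
  exact: inj_surj_bij (@Q_to_W_inj c) (@Q_to_W_surj c).
exact (@shift_iso _ _ _ _ _ _ inc ex su I L Wt _ e e_bij).
Qed.

End GSquared.

Theorem mainTheorem8 (G : group) :
  let S : fideal G := (f_ * f_ * r_ + r_ * f_ * f_)%fid in
  let Q := fquot (f_ * f_ * f_ * f_)%fid (S :&: f_ * f_ * f_ * f_)%fid in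
  let g2_tensor_g2 := ideal_tensor (g2 G) (g2 G) in
  [/\ is_constant Q,
      (* g^2 = ff / (r ∩ ff) *)
      nat_iso (ff_to_g2 G),
      (* Q is the image of the natural map [a] ⊗ [b] |-> [ab] *)
      (exists mu : nattrans (const_functor (Pres G) g2_tensor_g2)
                            (fquot (f_ * f_ * f_)%fid S),
         (forall (c : Pres G) (a b : group_ring (pgrp c))
                 (ffa : (f_ * f_)%fid c a) (ffb : (f_ * f_)%fid c b),
            mu c (ideal_tens (ff_to_g2 G c (scls ((r_ :&: f_ * f_)%fid c) ffa))
                             (ff_to_g2 G c (scls ((r_ :&: f_ * f_)%fid c) ffb)))
            = scls (S c) (fff_of_ffM ffa ffb)) /\
         (exists e : nattrans Q (image_functor mu),
            nat_iso e /\ forall c q, val (e c q) = ffff_to_fff G c q)) &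
      forall I : injective_resolution (fideal_functor S),
        (forall c : Pres G, ab_isomorphic (limi I 1) (Q c)) /\
        (forall i, (2 <= i)%N -> forall x : limi I i, x = 0)].
Proof.
split.
- exact: rigid_constant (@Q_rigid G).
- exact: ff_to_g2_bij.
- exists (mu G); split=> [c a b ffa ffb|].
    by apply: mu_atE; rewrite ff_to_g2_scls.
  by exists (to_image_mu G); split; [exact: to_image_mu_bij | ].
- exact: limi_S.
Qed.
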